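(* For any integers $n\geqslant 1$, $r\geqslant 3n$, and $2\leqslant s\leqslant n$, the Cremona group $\mathrm{Cr}_r$ of rank $r$ contains the group $\mathrm{Aut}(F_s)$ and, if $n\geqslant 3$, the braid group $B_n$ on $n$ strands.
   Context: $k$ is an algebraically closed field. $\mathrm{Cr}_r$ is the Cremona group of rank $r$ over $k$, i.e. the group of birational automorphisms over $k$ of the affine space $\mathbb{A}^r$. $F_s$ is a free group of rank $s$. A group $H$ contains a group $K$ if there is an injective homomorphism $K\hookrightarrow H$. *)

(* Defs.v *)
(* Written over MathComp, with multinomials for polynomials in r variables and
   mathcomp-classical for classical logic. *)
From HB Require Import structures.
From mathcomp Require Import all_boot all_algebra.
From mathcomp Require Import generic_quotient fraction.
From mathcomp Require Import boolp.
From mathcomp Require Import mpoly.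

Set Implicit Arguments.
Unset Strict Implicit.
Unset Printing Implicit Defensive.

Import GRing.Theory.

Definition contains_group (H K : groupType) : Prop :=
  exists f : {multiplicative K -> H}, injective f.

Section GroupAut.
Local Open Scope group_scope.
Variable G : groupType.

Definition is_group_aut (f : G -> G) : Prop :=
  {morph f : x y / x * y} /\ bijective f.

Record group_aut := GroupAut {
  group_aut_fun :> G -> G;
  _ : `[< is_group_aut group_aut_fun >] }.

HB.instance Definition _ := [isSub for group_aut_fun].
HB.instance Definition _ := [Choice of group_aut by <:].

Lemma group_autP (f : group_aut) : is_group_aut f.
Proof. by case: f => f /= /asboolP. Qed.

Lemma is_group_aut1 : is_group_aut idfun.
Proof. by split=> //; exists idfun. Qed.

Lemma is_group_autM (f g : group_aut) : is_group_aut (f \o g).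
Proof.
have [fM fbij] := group_autP f; have [gM gbij] := group_autP g.
by split; [move=> x y /=; rewrite gM fM | exact: bij_comp].
Qed.

Lemma group_aut_inv_subproof (f : group_aut) :
  exists g : G -> G, [/\ is_group_aut g, cancel f g & cancel g f].
Proof.
have [fM [g fK gK]] := group_autP f; exists g; split=> //; split; last first.
  by exists f.
by move=> x y; apply: (can_inj fK); rewrite fM !gK.
Qed.

Definition group_aut_one := GroupAut (asboolT is_group_aut1).
Definition group_aut_mul f g := GroupAut (asboolT (is_group_autM f g)).
Definition group_aut_inv f :=
  let: exist _ fP := cid (group_aut_inv_subproof f) in
  let: And3 gP _ _ := fP in GroupAut (asboolT gP).

Lemma group_aut_invK (f : group_aut) : @cancel G G f (group_aut_inv f).
Proof. by rewrite /group_aut_inv; case: cid => g []. Qed.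

Lemma group_aut_Kinv (f : group_aut) : @cancel G G (group_aut_inv f) f.
Proof. by rewrite /group_aut_inv; case: cid => g []. Qed.

Lemma group_aut_mulA : associative group_aut_mul.
Proof. by move=> f g h; apply: val_inj. Qed.
Lemma group_aut_mul1g : left_id group_aut_one group_aut_mul.
Proof. by move=> f; apply: val_inj. Qed.
Lemma group_aut_mulg1 : right_id group_aut_one group_aut_mul.
Proof. by move=> f; apply: val_inj. Qed.
Lemma group_aut_mulVg : left_inverse group_aut_one group_aut_inv group_aut_mul.
Proof.
by move=> f; apply: val_inj; apply/funext => x /=; rewrite group_aut_invK.
Qed.
Lemma group_aut_mulgV : right_inverse group_aut_one group_aut_inv group_aut_mul.
Proof.
by move=> f; apply: val_inj; apply/funext => x /=; rewrite group_aut_Kinv.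
Qed.

HB.instance Definition _ := isGroup.Build group_aut
  group_aut_mulA group_aut_mul1g group_aut_mulg1
  group_aut_mulVg group_aut_mulgV.

End GroupAut.

(* The group presented by generators X and relations u = v for rel u v. The
   letter (x, true) of a word stands for x, and (x, false) for its inverse. *)
Section PresentedGroup.
Variables (X : choiceType) (rel : seq (X * bool) -> seq (X * bool) -> Prop).
Local Notation word := (seq (X * bool)).

Inductive word_eq : word -> word -> Prop :=
| word_eq_refl u : word_eq u u
| word_eq_sym u v : word_eq u v -> word_eq v u
| word_eq_trans u v w : word_eq u v -> word_eq v w -> word_eq u w
| word_eq_cat u u' v v' :
    word_eq u u' -> word_eq v v' -> word_eq (u ++ v) (u' ++ v')
| word_eq_cancel x b : word_eq [:: (x, b); (x, ~~ b)] [::]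
| word_eq_rel u v : rel u v -> word_eq u v.

Definition word_eqb (u v : word) : bool := `[< word_eq u v >].

Lemma word_eqb_refl : reflexive word_eqb.
Proof. by move=> u; apply/asboolP/word_eq_refl. Qed.
Lemma word_eqb_sym : ssrbool.symmetric word_eqb.
Proof. by move=> u v; apply/asboolP/asboolP; apply: word_eq_sym. Qed.
Lemma word_eqb_trans : transitive word_eqb.
Proof.
move=> v u w /asboolP uv /asboolP vw; apply/asboolP.
exact: word_eq_trans vw.
Qed.

Canonical word_equiv := EquivRel word_eqb
  word_eqb_refl word_eqb_sym word_eqb_trans.

Local Open Scope quotient_scope.

Definition presented_group := {eq_quot word_eqb}.
HB.instance Definition _ := EqQuotient.on presented_group.
HB.instance Definition _ := Choice.on presented_group.

Lemma presented_eqP (u v : word) :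
  \pi_presented_group u = \pi_presented_group v <-> word_eq u v.
Proof. by split=> [/eqmodP/asboolP|uv]; last apply/eqmodP/asboolP. Qed.

Definition word_inv (u : word) : word := rev [seq (p.1, ~~ p.2) | p <- u].

Lemma word_inv_cat u v : word_inv (u ++ v) = word_inv v ++ word_inv u.
Proof. by rewrite /word_inv map_cat rev_cat. Qed.

Lemma word_invK : involutive word_inv.
Proof.
move=> u; rewrite /word_inv map_rev revK -map_comp -[RHS]map_id.
by apply: eq_map => -[x b] /=; rewrite negbK.
Qed.

Lemma word_eq_mulV u : word_eq (u ++ word_inv u) [::].
Proof.
elim: u => [|[x b] u IHu]; first exact: word_eq_refl.
rewrite -cat1s word_inv_cat -catA (catA u).
apply: word_eq_trans (word_eq_cancel x b).
apply: (@word_eq_cat [:: (x, b)] [:: (x, b)]); first exact: word_eq_refl.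
rewrite -[X in word_eq _ X]cat0s.
by apply: word_eq_cat => //; exact: word_eq_refl.
Qed.

Lemma word_eq_Vmul u : word_eq (word_inv u ++ u) [::].
Proof. by have := word_eq_mulV (word_inv u); rewrite word_invK. Qed.

Lemma word_eq_inv u v : word_eq u v -> word_eq (word_inv u) (word_inv v).
Proof.
move=> uv; have lt w : word_eq w w by exact: word_eq_refl.
apply: (@word_eq_trans _ (word_inv u ++ (v ++ word_inv v))).
  rewrite -{1}[word_inv u]cats0; apply: word_eq_cat => //.
  exact/word_eq_sym/word_eq_mulV.
rewrite catA -{2}[word_inv v]cat0s; apply: word_eq_cat => //.
apply: word_eq_trans (word_eq_Vmul u); apply: word_eq_cat => //.
exact: word_eq_sym.
Qed.

Definition presented_one : presented_group := \pi_presented_group [::].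
Definition presented_mul (a b : presented_group) : presented_group :=
  \pi_presented_group (repr a ++ repr b).
Definition presented_inv (a : presented_group) : presented_group :=
  \pi_presented_group (word_inv (repr a)).

Lemma word_eq_repr u : word_eq (repr (\pi_presented_group u)) u.
Proof. by apply/presented_eqP; rewrite reprK. Qed.

Lemma presented_mul_pi u v :
  presented_mul (\pi u) (\pi v) = \pi_presented_group (u ++ v).
Proof. by apply/presented_eqP/word_eq_cat; exact: word_eq_repr. Qed.

Lemma presented_inv_pi u : presented_inv (\pi u) = \pi_presented_group (word_inv u).
Proof. by apply/presented_eqP/word_eq_inv; exact: word_eq_repr. Qed.

Lemma presented_mulA : associative presented_mul.
Proof.
elim/quotW=> u; elim/quotW=> v; elim/quotW=> w.
by rewrite !presented_mul_pi catA.
Qed.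
Lemma presented_mul1g : left_id presented_one presented_mul.
Proof. by elim/quotW=> u; rewrite presented_mul_pi. Qed.
Lemma presented_mulg1 : right_id presented_one presented_mul.
Proof. by elim/quotW=> u; rewrite presented_mul_pi cats0. Qed.
Lemma presented_mulVg : left_inverse presented_one presented_inv presented_mul.
Proof.
elim/quotW=> u; rewrite presented_inv_pi presented_mul_pi.
exact/presented_eqP/word_eq_Vmul.
Qed.
Lemma presented_mulgV : right_inverse presented_one presented_inv presented_mul.
Proof.
elim/quotW=> u; rewrite presented_inv_pi presented_mul_pi.
exact/presented_eqP/word_eq_mulV.
Qed.

HB.instance Definition _ := isGroup.Build presented_group
  presented_mulA presented_mul1g presented_mulg1
  presented_mulVg presented_mulgV.

End PresentedGroup.

Definition free_group (s : nat) : groupType :=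
  presented_group (fun _ _ : seq ('I_s * bool) => False).

(* The generator i : 'I_n.-1 crosses the strands i and i.+1 (counted from 0). *)
Inductive braid_rel (n : nat) :
  seq ('I_n.-1 * bool) -> seq ('I_n.-1 * bool) -> Prop :=
| braid_far (i j : 'I_n.-1) : i.+1 < j ->
    braid_rel [:: (i, true); (j, true)] [:: (j, true); (i, true)]
| braid_adjacent (i j : 'I_n.-1) : j = i.+1 :> nat ->
    braid_rel [:: (i, true); (j, true); (i, true)]
              [:: (j, true); (i, true); (j, true)].

Definition braid_group (n : nat) : groupType := presented_group (@braid_rel n).

Section Cremona.
Local Open Scope ring_scope.
Variables (k : fieldType) (r : nat).
Local Notation K := {fraction {mpoly k[r]}}.

(* A rational map from A^r to itself, given by its r coordinate functions. *)
Definition rational_self_map := {ffun 'I_r -> K}.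
Implicit Types phi psi chi : rational_self_map.

Definition ratconst (c : k) : K := FracField.tofrac (mpolyC r c).
HB.instance Definition _ := GRing.RMorphism.copy ratconst
  (@FracField.tofrac {mpoly k[r]} \o @mpolyC r k).

Definition poly_pullback phi (p : {mpoly k[r]}) : K := mmap ratconst phi p.

(* The image of phi lies in no proper closed subset: no nonzero polynomial
   vanishes on it. *)
Definition dominant phi : Prop :=
  forall p : {mpoly k[r]}, p != 0 -> poly_pullback phi p != 0.

(* The function f \o phi. It does not depend on the representative of f, and
   the denominator does not vanish, as soon as phi is dominant; only this case
   is used. *)
Definition pullback phi (f : K) : K :=
  poly_pullback phi (\n_(repr f)) / poly_pullback phi (\d_(repr f)).

Definition rational_id : rational_self_map :=
  [ffun i => FracField.tofrac 'X_i].

(* psi after phi *)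
Definition rational_comp psi phi : rational_self_map :=
  [ffun i => pullback phi (psi i)].

Definition birational phi : Prop :=
  dominant phi /\ exists psi, [/\ dominant psi,
    rational_comp psi phi = rational_id & rational_comp phi psi = rational_id].

HB.instance Definition _ phi := GRing.RMorphism.copy (poly_pullback phi)
  (mmap ratconst phi).

Lemma ratio_repr (f : K) :
  f = FracField.tofrac (\n_(repr f)) / FracField.tofrac (\d_(repr f)).
Proof.
have dn0 : FracField.tofrac (\d_(repr f)) != 0 :> K.
  by rewrite tofrac_eq0 denom_ratioP.
apply: (mulIf dn0); rewrite divfK // -{1}[f]reprK; unlock FracField.tofrac.
rewrite -[LHS]FracField.pi_mul; apply/eqmodP; rewrite /= FracField.equivfE.
rewrite /FracField.mulf !numden_Ratio ?oner_neq0 ?mulf_neq0 ?denom_ratioP //.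
  by rewrite !mulr1 mulrC.
all: exact: oner_neq0.
Qed.

Lemma poly_pullbackM phi :
  {morph poly_pullback phi : p q / p * q}.
Proof. exact: rmorphM. Qed.

Lemma poly_pullbackD phi :
  {morph poly_pullback phi : p q / p + q}.
Proof. exact: rmorphD. Qed.

Lemma pullback_ratio phi : dominant phi -> forall p q : {mpoly k[r]}, q != 0 ->
  pullback phi (FracField.tofrac p / FracField.tofrac q) =
  poly_pullback phi p / poly_pullback phi q.
Proof.
move=> domphi p q q0; rewrite /pullback.
move: (ratio_repr (FracField.tofrac p / FracField.tofrac q)).
move: (denom_ratioP (repr (FracField.tofrac p / FracField.tofrac q))).
move: (repr _) => [[n d] ?] /= d0 /eqP.
rewrite eqr_div ?tofrac_eq0 // -!tofracM tofrac_eq => /eqP pE.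
apply/eqP; rewrite eqr_div ?domphi // -!poly_pullbackM pE.
exact: eqxx.
Qed.

Lemma pullback_tofrac phi : dominant phi -> forall p : {mpoly k[r]},
  pullback phi (FracField.tofrac p) = poly_pullback phi p.
Proof.
move=> domphi p; have := pullback_ratio domphi p (oner_neq0 _).
by rewrite !rmorph1 !divr1.
Qed.

Lemma pullbackM phi : dominant phi -> {morph pullback phi : f g / f * g}.
Proof.
move=> domphi f g; rewrite [f]ratio_repr [g]ratio_repr.
rewrite mulf_div -!tofracM !pullback_ratio ?mulf_neq0 ?denom_ratioP //.
by rewrite mulf_div !poly_pullbackM.
Qed.

Lemma pullbackD phi : dominant phi -> {morph pullback phi : f g / f + g}.
Proof.
move=> domphi f g; rewrite [f]ratio_repr [g]ratio_repr.
rewrite addf_div ?tofrac_eq0 ?denom_ratioP // -!(tofracM, tofracD).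
rewrite !pullback_ratio ?mulf_neq0 ?denom_ratioP //.
rewrite addf_div ?domphi ?denom_ratioP //.
by rewrite !(poly_pullbackM, poly_pullbackD).
Qed.

Lemma pullback0 phi : dominant phi -> pullback phi 0 = 0.
Proof.
by move=> domphi; rewrite -[0 in LHS]tofrac0 pullback_tofrac ?rmorph0.
Qed.

Lemma pullback1 phi : dominant phi -> pullback phi 1 = 1.
Proof.
by move=> domphi; rewrite -[1 in LHS]tofrac1 pullback_tofrac ?rmorph1.
Qed.

Lemma pullback_eq0 phi : dominant phi -> forall f : K,
  (pullback phi f == 0) = (f == 0).
Proof.
move=> domphi f; have [->|f0] := eqVneq f 0; first by rewrite pullback0 ?eqxx.
apply/negP => /eqP phif0; have /eqP := pullbackM domphi f f^-1.
by rewrite mulfV // pullback1 // phif0 mul0r oner_eq0.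
Qed.

Lemma pullbackX phi : dominant phi -> forall n, 
  {morph pullback phi : f / f ^+ n}.
Proof.
move=> domphi n f; elim: n => [|n IHn]; first by rewrite !expr0 pullback1.
by rewrite !exprS pullbackM // IHn.
Qed.

Lemma poly_pullback_comp psi phi : dominant phi -> forall p : {mpoly k[r]},
  poly_pullback (rational_comp psi phi) p = pullback phi (poly_pullback psi p).
Proof.
move=> domphi p; rewrite /poly_pullback /mmap.
rewrite (big_morph _ (pullbackD domphi) (pullback0 domphi)).
apply: eq_bigr => m _; rewrite pullbackM //; congr (_ * _).
  by rewrite [in RHS]/ratconst pullback_tofrac // /poly_pullback mmapC.
rewrite /mmap1 (big_morph _ (pullbackM domphi) (pullback1 domphi)).
by apply: eq_bigr => i _; rewrite pullbackX // ffunE.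
Qed.

Lemma dominant_comp psi phi :
  dominant psi -> dominant phi -> dominant (rational_comp psi phi).
Proof.
move=> dompsi domphi p p0.
by rewrite poly_pullback_comp // pullback_eq0 // dompsi.
Qed.

Lemma pullback_comp psi phi : dominant psi -> dominant phi -> forall f : K,
  pullback (rational_comp psi phi) f = pullback phi (pullback psi f).
Proof.
move=> dompsi domphi f; rewrite [LHS]/pullback [pullback psi f]/pullback.
have d0 : poly_pullback psi \d_(repr f) != 0 by rewrite dompsi ?denom_ratioP.
rewrite !poly_pullback_comp //.
apply: (canLR (mulfK _)); first by rewrite pullback_eq0.
by rewrite -pullbackM // divfK.
Qed.

Lemma rational_compA psi phi chi : dominant phi -> dominant chi ->
  rational_comp psi (rational_comp phi chi) =
  rational_comp (rational_comp psi phi) chi.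
Proof. by move=> ? ?; apply/ffunP=> i; rewrite !ffunE pullback_comp. Qed.

Lemma poly_pullback_id p : poly_pullback rational_id p = FracField.tofrac p.
Proof.
rewrite [p in RHS]mpolyE rmorph_sum /poly_pullback /mmap /=.
apply: eq_bigr => m _; rewrite -mul_mpolyC rmorphM /=; congr (_ * _).
rewrite [in RHS]mpolyXE_id rmorph_prod /mmap1 /=.
by apply: eq_bigr => i _; rewrite ffunE rmorphXn.
Qed.

Lemma dominant_id : dominant rational_id.
Proof. by move=> p p0; rewrite poly_pullback_id tofrac_eq0. Qed.

Lemma pullback_id f : pullback rational_id f = f.
Proof. by rewrite /pullback !poly_pullback_id -ratio_repr. Qed.

Lemma rational_compf1 phi : rational_comp phi rational_id = phi.
Proof. by apply/ffunP=> i; rewrite ffunE pullback_id. Qed.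

Lemma rational_comp1f phi : dominant phi -> rational_comp rational_id phi = phi.
Proof.
move=> domphi; apply/ffunP=> i; rewrite !ffunE pullback_tofrac //.
by rewrite /poly_pullback mmapX mmap1U.
Qed.

Lemma birational_id : birational rational_id.
Proof.
have domid := dominant_id.
by split=> //; exists rational_id; rewrite rational_compf1.
Qed.

Lemma birational_comp psi phi :
  birational psi -> birational phi -> birational (rational_comp psi phi).
Proof.
move=> [dpsi [psi' [dpsi' psiK psi'K]]] [dphi [phi' [dphi' phiK phi'K]]].
split; first exact: dominant_comp.
exists (rational_comp phi' psi'); split; first exact: dominant_comp.
  rewrite (rational_compA _ dpsi dphi) -(rational_compA phi' dpsi' dpsi).
  by rewrite psiK rational_compf1.
rewrite (rational_compA _ dphi' dpsi') -(rational_compA psi dphi dphi').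
by rewrite phi'K rational_compf1.
Qed.

Record cremona := Cremona {
  cremona_map :> rational_self_map;
  _ : `[< birational cremona_map >] }.

HB.instance Definition _ := [isSub for cremona_map].
HB.instance Definition _ := [Choice of cremona by <:].

Implicit Types f g h : cremona.

Lemma cremonaP f : birational f.
Proof. by case: f => f /= /asboolP. Qed.

Lemma cremona_dominant f : dominant f.
Proof. by case: (cremonaP f). Qed.

Lemma cremona_inv_subproof f : exists psi, [/\ birational psi,
  rational_comp psi f = rational_id & rational_comp f psi = rational_id].
Proof.
have [domf [psi [dompsi psiK Kpsi]]] := cremonaP f.
by exists psi; split=> //; split=> //; exists f.
Qed.

Definition cremona_one := Cremona (asboolT birational_id).
Definition cremona_mul f g :=
  Cremona (asboolT (birational_comp (cremonaP f) (cremonaP g))).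
Definition cremona_inv f :=
  let: exist _ psiP := cid (cremona_inv_subproof f) in
  let: And3 bpsi _ _ := psiP in Cremona (asboolT bpsi).

Lemma cremona_mulA : associative cremona_mul.
Proof.
by move=> f g h; apply/val_inj/rational_compA; exact: cremona_dominant.
Qed.
Lemma cremona_mul1g : left_id cremona_one cremona_mul.
Proof.
by move=> f; apply/val_inj/rational_comp1f; exact: cremona_dominant.
Qed.
Lemma cremona_mulg1 : right_id cremona_one cremona_mul.
Proof. by move=> f; apply/val_inj/rational_compf1. Qed.
Lemma cremona_mulVg : left_inverse cremona_one cremona_inv cremona_mul.
Proof.
by move=> f; apply: val_inj; rewrite /cremona_inv; case: cid => psi [].
Qed.
Lemma cremona_mulgV : right_inverse cremona_one cremona_inv cremona_mul.
Proof.
by move=> f; apply: val_inj; rewrite /cremona_inv; case: cid => psi [].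
Qed.

HB.instance Definition _ := isGroup.Build cremona
  cremona_mulA cremona_mul1g cremona_mulg1 cremona_mulVg cremona_mulgV.

End Cremona.

(* Main.v *)
(* Aut(F_s) acts on SL_2^s = Hom(F_s, SL_2), a rational variety of dimension 3s;
   the function field of A^r contains that of SL_2^s in the first 3s variables.
   The action is faithful because generic matrices generate a free group: they
   specialize to loxodromic matrices t^-1 P + t P' with distinct fixed points,
   where P, P' are complementary projections of rank 1, and the term of lowest
   order in t of a reduced word is a nonzero product of such projections.

   The braid group B_n embeds into Aut(F_n) by Artin's theorem, proved here by
   combing. A braid on m+1 strands is h u c, where h is a braid on the first m
   strands, u is in the subgroup U generated by the pure braids A_j, j < m,
     which
   wind the strand m around the strand j, and c is one of m+1 coset
   representatives. If h u c acts trivially on F_n then the permutation of the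
   conjugacy classes of the generators gives c = 1. Killing the generator x_m,
   and all later ones, makes u act trivially, so h acts trivially, and h = 1 by
   induction. Finally u maps x_m to a conjugate of x_m, and modulo x_m the
   conjugating element spells u as a word in the A_j, with x_j in place of A_j;
   as u fixes x_m, that word is trivial and u = 1. *)
Require Import Defs.
From HB Require Import structures.
From mathcomp Require Import all_boot all_algebra.
From mathcomp Require Import generic_quotient fraction.
From mathcomp Require Import boolp.
From mathcomp Require Import mpoly.
From mathcomp Require Import zify ring.

Set Implicit Arguments.
Unset Strict Implicit.
Unset Printing Implicit Defensive.

Import GRing.Theory.

(** * Homomorphisms from presented groups *)

HB.instance Definition _ (G : groupType) (f : group_aut G) :=
  isMultiplicative.Build G G f (proj1 (group_autP f)).

Lemma gmulf1_group (G H : groupType) (f : G -> H) :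
  {morph f : x y / (x * y)%g} -> f 1%g = 1%g.
Proof. by move=> fM; apply: (mulgI (f 1%g)); rewrite -fM !mulg1. Qed.

HB.instance Definition _ (G : groupType) (f : group_aut G) :=
  Multiplicative_isUMagmaMorphism.Build G G f
    (gmulf1_group (proj1 (group_autP f))).

Lemma group_aut_eq (G : groupType) (f g : group_aut G) : f =1 g -> f = g.
Proof. by move=> fg; apply/val_inj/funext. Qed.

Section GroupAutMorph.
Local Open Scope group_scope.
Variables (G : groupType) (f : group_aut G).

Lemma group_aut1 : f 1 = 1. Proof. exact: gmulf1. Qed.
Lemma group_autM : {morph f : a b / a * b}. Proof. exact: gmulfM. Qed.
Lemma group_autV : {morph f : a / a^-1}. Proof. exact: gmulfV. Qed.
Lemma group_autJ : {morph f : a b / a ^ b}. Proof. exact: gmulfJ. Qed.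

End GroupAutMorph.

Section PresentedHom.
Local Open Scope group_scope.
Variables (X : choiceType) (rel : seq (X * bool) -> seq (X * bool) -> Prop).
Local Notation P := (presented_group rel).
Local Notation pi_word := (\pi_(presented_group rel))%qT.

(** Induction on [word_eq]. Letters act by mutually inverse maps on a bare type, so the result
    serves group values, matrices and the wreath action alike. *)
Lemma foldr_word_eq (T : Type) (f : X * bool -> T -> T) :
    (forall x b, cancel (f (x, ~~ b)) (f (x, b))) ->
    (forall u v, rel u v -> foldr f ^~ u =1 foldr f ^~ v) ->
  forall u v, word_eq rel u v -> foldr f ^~ u =1 foldr f ^~ v.
Proof.
move=> fK frel u v; elim=> {u v} //=.
- by move=> u v _ uv t; rewrite uv.
- by move=> u v w _ uv _ vw t; rewrite uv.
- by move=> u u' v v' _ uu' _ vv' t; rewrite !foldr_cat vv' uu'.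
Qed.

Definition presented_gen x : P := pi_word [:: (x, true)].

Lemma presented_piM u v : pi_word u * pi_word v = pi_word (u ++ v).
Proof. exact: presented_mul_pi. Qed.

Lemma presented_pi_cons p u :
  pi_word (p :: u) =
    (if p.2 then presented_gen p.1 else (presented_gen p.1)^-1) * pi_word u.
Proof.
case: p => x [] /=; first by rewrite presented_piM.
by rewrite -[_^-1]/(presented_inv _) presented_inv_pi presented_piM.
Qed.

Definition presented_act (T : Type) (f : X * bool -> T -> T) (a : P) (t : T) :=
  foldr f t (repr a).

Section PresentedAct.
Variables (T : Type) (f : X * bool -> T -> T).
Hypothesis fK : forall x b, cancel (f (x, ~~ b)) (f (x, b)).
Hypothesis frel : forall u v, rel u v -> foldr f ^~ u =1 foldr f ^~ v.

Lemma presented_act_pi u t : presented_act f (pi_word u) t = foldr f t u.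
Proof. exact/(foldr_word_eq fK frel)/word_eq_repr. Qed.

Lemma presented_act1 t : presented_act f 1 t = t.
Proof. exact: presented_act_pi. Qed.

Lemma presented_actM a b t :
  presented_act f (a * b) t = presented_act f a (presented_act f b t).
Proof.
rewrite -[a in LHS]reprK -[b in LHS]reprK presented_piM presented_act_pi.
exact: foldr_cat.
Qed.

Lemma presented_act_gen x t : presented_act f (presented_gen x) t = f (x,
  true) t.
Proof. exact: presented_act_pi. Qed.

Lemma presented_act_genV x t :
  presented_act f (presented_gen x)^-1 t = f (x, false) t.
Proof.
by rewrite -[_^-1]/(presented_inv _) presented_inv_pi presented_act_pi.
Qed.

End PresentedAct.

Variables (G : groupType) (g : X -> G).

Definition word_letter (p : X * bool) : G := if p.2 then g p.1 else (g p.1)^-1.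
Definition word_val (u : seq (X * bool)) : G := \prod_(p <- u) word_letter p.
Definition respects_rel := forall u v, rel u v -> word_val u = word_val v.

Lemma word_val_eq : respects_rel ->
  forall u v, word_eq rel u v -> word_val u = word_val v.
Proof.
move=> grel u v uv; pose f p t := word_letter p * t.
have fE w t : foldr f t w = word_val w * t.
  rewrite /word_val; elim: w => [|p w IHw] /=; first by rewrite big_nil mul1g.
  by rewrite IHw big_cons /f mulgA.
have := @foldr_word_eq _ f _ _ _ _ uv 1; rewrite !fE !mulg1; apply.
- by move=> x [] t; rewrite /f /word_letter /= ?mulKg ?mulVKg.
- by move=> u' v' uv' t; rewrite !fE (grel _ _ uv').
Qed.

Hypothesis grel : respects_rel.

(** The proof that the relations hold is an argument, so that the morphism structure can be inferred
    from the term. *)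
Definition presented_hom of respects_rel := fun a : P => word_val (repr a).
Local Notation h := (presented_hom grel).

Lemma presented_hom_pi u : h (pi_word u) = word_val u.
Proof. exact/word_val_eq/word_eq_repr. Qed.

Lemma presented_homM : {morph h : a b / a * b}.
Proof.
move=> a b; rewrite -[a]reprK -[b]reprK presented_piM !presented_hom_pi.
by rewrite /word_val big_cat.
Qed.
HB.instance Definition _ := isMultiplicative.Build P G h presented_homM.
HB.instance Definition _ :=
  Multiplicative_isUMagmaMorphism.Build P G h (gmulf1_group presented_homM).

Lemma presented_hom_gen x : h (presented_gen x) = g x.
Proof. by rewrite presented_hom_pi /word_val big_seq1. Qed.

Lemma presented_ind (Q : P -> Prop) :
  Q 1 -> (forall x a, Q a -> Q (presented_gen x * a)) ->
  (forall x a, Q a -> Q ((presented_gen x)^-1 * a)) -> forall a, Q a.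
Proof.
move=> Q1 QM QV; elim/quotW; elim=> [|[x []] u Qu]; first exact: Q1.
  by rewrite presented_pi_cons; apply: QM.
by rewrite presented_pi_cons; apply: QV.
Qed.

Lemma presented_hom_ext (f1 f2 : UMagmaMorphism.type P G) :
  (forall x, f1 (presented_gen x) = f2 (presented_gen x)) -> f1 =1 f2.
Proof.
move=> f12; apply: presented_ind => [|x a fa|x a fa]; first by rewrite !gmulf1.
  by rewrite !gmulfM f12 fa.
by rewrite !gmulfM !gmulfV f12 fa.
Qed.

End PresentedHom.

(** * The Artin action *)

Section FreeGroup.
Local Open Scope group_scope.
Variable n : nat.
Local Notation F := (free_group n).

(* Indexing by nat, with junk value 1 from n on, avoids ordinal arithmetic. *)
Definition free_gen (i : nat) : F :=
  if insub i is Some j then presented_gen _ j else 1.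

Lemma free_gen_out i : n <= i -> free_gen i = 1.
Proof. by move=> ni; rewrite /free_gen insubN // -leqNgt. Qed.

Lemma free_gen_ord (j : 'I_n) : free_gen j = presented_gen _ j.
Proof. by rewrite /free_gen valK. Qed.

Lemma free_respects (G : groupType) (g : 'I_n -> G) :
  respects_rel (fun _ _ => False) g.
Proof. by []. Qed.

Definition free_hom (G : groupType) (g : nat -> G) : F -> G :=
  presented_hom (free_respects (fun i : 'I_n => g i)).
HB.instance Definition _ (G : groupType) (g : nat -> G) :=
  UMagmaMorphism.copy (free_hom g)
    (presented_hom (free_respects (fun i : 'I_n => g i))).

Lemma free_homE (G : groupType) (g : nat -> G) i :
  i < n -> free_hom g (free_gen i) = g i.
Proof.
move=> i_n; rewrite -[i]/(val (Ordinal i_n)) free_gen_ord.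
exact: presented_hom_gen.
Qed.

Lemma free_hom_ext (G : groupType) (f1 f2 : UMagmaMorphism.type F G) :
  (forall i, i < n -> f1 (free_gen i) = f2 (free_gen i)) -> f1 =1 f2.
Proof.
by move=> f12; apply: presented_hom_ext => x; rewrite -free_gen_ord f12.
Qed.

Lemma free_aut_ext (f1 f2 : group_aut F) :
  (forall i, i < n -> f1 (free_gen i) = f2 (free_gen i)) -> f1 = f2.
Proof. by move=> f12; apply/group_aut_eq/free_hom_ext. Qed.

Lemma free_ind (Q : F -> Prop) :
    Q 1 -> (forall i a, i < n -> Q a -> Q (free_gen i * a)) ->
    (forall i a, i < n -> Q a -> Q ((free_gen i)^-1 * a)) ->
  forall a, Q a.
Proof.
move=> Q1 QM QV; apply: presented_ind => // x a Qa; rewrite -free_gen_ord.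
  exact: QM.
exact: QV.
Qed.

End FreeGroup.

Section BraidGroup.
Local Open Scope group_scope.
Variable n : nat.
Local Notation B := (braid_group n).

Definition braid_gen (i : nat) : B :=
  if insub i is Some j then presented_gen _ j else 1.
Local Notation s := braid_gen.

Lemma braid_gen_out i : n.-1 <= i -> s i = 1.
Proof. by move=> ni; rewrite /braid_gen insubN // -leqNgt. Qed.

Lemma braid_gen_ord (j : 'I_n.-1) : s j = presented_gen _ j.
Proof. by rewrite /braid_gen valK. Qed.

Lemma braid_respects (G : groupType) (g : nat -> G) :
    (forall i j, i.+1 < j -> j.+1 < n -> commute (g i) (g j)) ->
    (forall i, i.+2 < n -> g i * g i.+1 * g i = g i.+1 * g i * g i.+1) ->
  respects_rel (@braid_rel n) (fun i : 'I_n.-1 => g i).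
Proof.
move=> gC gB u v [] i j ij;
  rewrite /word_val !big_cons !big_nil /word_letter /=.
  by rewrite !mulg1 gC //; have := ltn_ord j; lia.
by rewrite !mulg1 ij !mulgA gB //; have := ltn_ord j; lia.
Qed.

Lemma braid_gen_comm i j : i.+1 < j -> commute (s i) (s j).
Proof.
move=> ij; have [jn|/braid_gen_out->] := ltnP j n.-1; last exact: commute1.
have i_n : i < n.-1 by lia.
rewrite (braid_gen_ord (Ordinal i_n)) (braid_gen_ord (Ordinal jn)).
rewrite /commute /presented_gen !presented_piM.
exact/presented_eqP/word_eq_rel/braid_far.
Qed.

Lemma braid_gen_braid i : i.+2 < n ->
  s i * s i.+1 * s i = s i.+1 * s i * s i.+1.
Proof.
move=> i2n; have i_n : i < n.-1 by lia. have i1n : i.+1 < n.-1 by lia.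
rewrite (braid_gen_ord (Ordinal i_n)) (braid_gen_ord (Ordinal i1n)).
have gen3 a b c : presented_gen (@braid_rel n) a * presented_gen _ b *
    presented_gen _ c = \pi_B%qT [:: (a, true); (b, true); (c, true)].
  by rewrite (presented_piM _ [:: _] [:: _]) presented_piM.
rewrite !gen3; exact/presented_eqP/word_eq_rel/braid_adjacent.
Qed.

End BraidGroup.

Section ArtinAction.
Local Open Scope group_scope.
Variable n : nat.
Local Notation F := (free_group n).
Local Notation B := (braid_group n).
Local Notation x := (@free_gen n).

(** The half twist of the punctures i and i+1; it preserves the product [x i * x i.+1]. Out of range
    it is the identity, in agreement with [braid_gen]. *)
Definition artin_gen_img (i j : nat) : F :=
  if i.+1 < n then
    if j == i then x i.+1 else if j == i.+1 then x i ^ x i.+1 else x j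
  else x j.

Definition artin_gen_inv_img (i j : nat) : F :=
  if i.+1 < n then
    if j == i then x i.+1 ^ (x i)^-1 else if j == i.+1 then x i else x j
  else x j.

Lemma artin_genK i :
  cancel (free_hom (artin_gen_img i)) (free_hom (artin_gen_inv_img i)).
Proof.
move=> a; rewrite -[LHS]/((free_hom _ \o free_hom _) a) -[RHS]/(idfun a).
apply: free_hom_ext => j jn /=; rewrite free_homE // /artin_gen_img.
case: ltnP => [i1n|ni]; last by rewrite free_homE // /artin_gen_inv_img ltnNge
  ni.
have i_n := ltnW i1n.
have [->|ji] := eqVneq j i.
  by rewrite free_homE // /artin_gen_inv_img i1n eqxx ifF //; lia.
have [->|ji1] := eqVneq j i.+1; last first.
  by rewrite free_homE // /artin_gen_inv_img i1n (negPf ji) (negPf ji1).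
rewrite gmulfJ /= !free_homE // /artin_gen_inv_img i1n !eqxx ifF; last by lia.
by rewrite conjgKV.
Qed.

Lemma artin_genKV i :
  cancel (free_hom (artin_gen_inv_img i)) (free_hom (artin_gen_img i)).
Proof.
move=> a; rewrite -[LHS]/((free_hom _ \o free_hom _) a) -[RHS]/(idfun a).
apply: free_hom_ext => j jn /=; rewrite free_homE // /artin_gen_inv_img.
case: ltnP => [i1n|ni]; last by rewrite free_homE // /artin_gen_img ltnNge ni.
have i_n := ltnW i1n.
have [->|ji] := eqVneq j i.
  rewrite gmulfJ gmulfV /= !free_homE // /artin_gen_img i1n !eqxx ifF;
    last by lia.
  by rewrite conjgK.
have [->|ji1] := eqVneq j i.+1.
  by rewrite free_homE // /artin_gen_img i1n eqxx.
by rewrite free_homE // /artin_gen_img i1n (negPf ji) (negPf ji1).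
Qed.

Lemma artin_gen_aut i : is_group_aut (free_hom (artin_gen_img i)).
Proof.
split; first exact: gmulfM.
exists (free_hom (artin_gen_inv_img i)); [exact: artin_genK|exact: artin_genKV].
Qed.

Definition artin_gen i : group_aut F := GroupAut (asboolT (artin_gen_aut i)).
Local Notation t := artin_gen.

Lemma artin_gen_id i j : j != i -> j != i.+1 -> t i (x j) = x j.
Proof.
move=> /negPf ji /negPf ji1; have [jn|/free_gen_out->] := ltnP j n;
  last exact: group_aut1.
by rewrite /= free_homE // /artin_gen_img ji ji1 if_same.
Qed.

Lemma artin_gen_l i : i.+1 < n -> t i (x i) = x i.+1.
Proof. by move=> i1n; rewrite /= free_homE ?(ltnW i1n) // /artin_gen_img i1n
  eqxx. Qed.

Lemma artin_gen_r i : i.+1 < n -> t i (x i.+1) = x i ^ x i.+1.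
Proof.
by move=> i1n; rewrite /= free_homE // /artin_gen_img i1n eqxx ifF //; lia.
Qed.

Lemma artin_gen_out i : n.-1 <= i -> t i = 1.
Proof.
move=> ni; apply: free_aut_ext => j jn /=; rewrite free_homE // /artin_gen_img.
by rewrite ifF //; lia.
Qed.

Lemma artin_gen_comm i j : i.+1 < j -> j.+1 < n -> commute (t i) (t j).
Proof.
move=> ij jn; have i1n : i.+1 < n by lia.
apply: free_aut_ext => k kn; rewrite -[LHS]/(t i (t j _)) -[RHS]/(t j (t i _)).
have [->|ki] := eqVneq k i.
  by rewrite (@artin_gen_id j) ?artin_gen_l ?artin_gen_id //; lia.
have [->|ki1] := eqVneq k i.+1.
  by rewrite (@artin_gen_id j) ?artin_gen_r ?group_autJ ?artin_gen_id //; lia.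
have [->|kj] := eqVneq k j.
  by rewrite (@artin_gen_id i j) ?artin_gen_l ?artin_gen_id //; lia.
have [->|kj1] := eqVneq k j.+1.
  by rewrite (@artin_gen_id i j.+1) ?artin_gen_r ?group_autJ ?artin_gen_id //;
    lia.
by rewrite !artin_gen_id.
Qed.

Lemma artin_gen_braid i : i.+2 < n ->
  t i * t i.+1 * t i = t i.+1 * t i * t i.+1.
Proof.
move=> i2n; have i1n := ltnW i2n.
apply: free_aut_ext => k kn.
rewrite -[LHS]/(t i (t i.+1 (t i _))) -[RHS]/(t i.+1 (t i (t i.+1 _))).
have [->|ki] := eqVneq k i.
  rewrite (@artin_gen_id i.+1 i) ?artin_gen_l //; try lia.
  by rewrite artin_gen_id //; lia.
have [->|ki1] := eqVneq k i.+1.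
  rewrite artin_gen_r // group_autJ artin_gen_l // (@artin_gen_id i.+1 i);
    try lia.
  rewrite group_autJ artin_gen_l // (@artin_gen_id i i.+2); try lia.
  by rewrite artin_gen_r.
have [->|ki2] := eqVneq k i.+2.
  rewrite (@artin_gen_id i i.+2); try lia.
  rewrite artin_gen_r // !group_autJ artin_gen_r // (@artin_gen_id i i.+2);
    try lia.
  rewrite !group_autJ artin_gen_r // (@artin_gen_id i.+1 i); try lia.
  by rewrite artin_gen_l // -conjJg.
by rewrite !artin_gen_id.
Qed.

Definition artin_respects := braid_respects artin_gen_comm artin_gen_braid.

Definition artin : B -> group_aut F := presented_hom artin_respects.
HB.instance Definition _ :=
  UMagmaMorphism.copy artin (presented_hom artin_respects).

Lemma artinE i : artin (braid_gen n i) = t i.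
Proof.
have [ni|ni] := ltnP i n.-1;
  last by rewrite braid_gen_out // artin_gen_out // gmulf1.
rewrite -[i]/(val (Ordinal ni)) braid_gen_ord; exact: presented_hom_gen.
Qed.

End ArtinAction.

(** * Combing *)

(** Suited to [strand_down k], which is trivial at k = m and gains one letter each time k drops. *)
Lemma descending_ind m (P : nat -> Prop) :
  P m -> (forall k, k < m -> P k.+1 -> P k) -> forall k, k <= m -> P k.
Proof.
move=> Pm PS k km; rewrite -(subKn km);
  elim: (m - k) (leq_subr k m) => [|d IHd] dm.
  by rewrite subn0.
apply: PS; first by lia.
by rewrite (_ : (m - d.+1).+1 = m - d); [apply: IHd; lia | lia].
Qed.

Section Combing.
Local Open Scope group_scope.
Variables (n m : nat).
Hypothesis m_lt_n : m < n.
Local Notation F := (free_group n).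
Local Notation B := (braid_group n).
Local Notation s := (@braid_gen n).
Local Notation x := (@free_gen n).

(* [strand_down k] is s_{m-1} s_{m-2} ... s_k. *)
Fixpoint strand_down_rec d : B :=
  if d is d'.+1 then strand_down_rec d' * s (m - d) else 1.
Definition strand_down k := strand_down_rec (m - k).
Local Notation tau := strand_down.

Lemma strand_down_top : tau m = 1.
Proof. by rewrite /tau subnn. Qed.

Lemma strand_downS k : k < m -> tau k = tau k.+1 * s k.
Proof.
move=> km; rewrite /tau (_ : m - k = (m - k.+1).+1) /=; last by lia.
by congr (_ * s _); lia.
Qed.

Lemma strand_down_comm i k : i.+1 < k -> k <= m -> commute (s i) (tau k).
Proof.
move=> ik km; move: k km ik; apply: descending_ind => [|k km IHk] ik.
  by rewrite strand_down_top; apply: commute1.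
rewrite strand_downS //; apply: commuteM; first by apply: IHk; lia.
exact: braid_gen_comm.
Qed.

(** For k < i the last letter s_k commutes with s_{i+1}, which reduces to k = i. There one braid
    relation turns s_{i+1} s_i s_{i+1} into s_i s_{i+1} s_i, and its first letter commutes with
    [tau i.+2]. *)
Lemma strand_down_shift k i : k <= i -> i.+1 < m ->
  tau k * s i.+1 = s i * tau k.
Proof.
move=> ki im; have km : k <= m by lia.
move: k km ki; apply: descending_ind => [|k km IHk] ki; first by lia.
rewrite strand_downS // -mulgA.
have [->|ki'] := eqVneq k i.
  rewrite strand_downS // -!mulgA (mulgA (s i.+1)) -braid_gen_braid;
    last by lia.
  by rewrite !mulgA (strand_down_comm (ltnSn _)).
by rewrite (@braid_gen_comm _ k i.+1) ?mulgA ?IHk //; lia.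
Qed.

(* Locked, lest rewriting with [mulgA] see the product inside. *)
Definition pure_gen j : B := locked ((s j * s j) ^ (tau j.+1)^-1).
Local Notation A := pure_gen.

Lemma pure_genE j : A j = (s j * s j) ^ (tau j.+1)^-1.
Proof. by rewrite /A -lock. Qed.

Lemma pure_gen_tau j : j < m -> A j * tau j.+1 = tau j * s j.
Proof.
by move=> jm; rewrite pure_genE /conjg invgK !mulgA mulgVK (strand_downS jm).
Qed.

Lemma conjg_fixed (G : groupType) (a b : G) : commute a b -> a ^ b = a.
Proof. by move=> ab; rewrite /conjg ab mulKg. Qed.

Lemma conjg_fixedV (G : groupType) (a b : G) : a ^ b = a -> a ^ b^-1 = a.
Proof. by move=> {1}<-; rewrite conjgK. Qed.

(** For i + 1 < j, s_i commutes with every letter of A_j. For j < i, it crosses [tau j.+1] by the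
    shift and becomes s_{i+1}, which commutes with s_j. *)
Lemma pure_gen_fixed i j : i.+1 < m -> j < m -> i != j -> i.+1 != j ->
  A j ^ s i = A j.
Proof.
move=> im jm ij i1j; rewrite pure_genE -conjgM; have [lt_ij|le_ji] := ltnP i j.
  have i1_j : i.+1 < j by lia.
  rewrite -(commuteV (strand_down_comm _ jm)); last by lia.
  rewrite conjgM; congr (_ ^ _); apply/conjg_fixed/commute_sym.
  by apply: commuteM; apply: braid_gen_comm.
have ji : j < i by lia.
have <- : s i.+1 * (tau j.+1)^-1 = (tau j.+1)^-1 * s i.
  apply: (mulgI (tau j.+1)); rewrite mulgA strand_down_shift //.
  by rewrite mulgK mulVKg.
rewrite conjgM; congr (_ ^ _); apply/conjg_fixed/commute_sym.
by apply: commuteM; apply/commute_sym/braid_gen_comm; lia.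
Qed.

(** After [tau j.+2] is split off, this is the braid relation in the form: conjugation by (s_j
    s_{j+1})^-1 takes s_j to s_{j+1}. *)
Lemma pure_gen_up j : j.+1 < m -> A j ^ (s j)^-1 = A j.+1.
Proof.
move=> jm; have tauC := commuteV (strand_down_comm (ltnSn j.+1) jm).
rewrite !pure_genE strand_downS // invgM -!conjgM -mulgA.
have -> : (tau j.+2)^-1 * (s j)^-1 = (s j)^-1 * (tau j.+2)^-1.
  by rewrite -invgM (strand_down_comm (ltnSn _)) ?invgM.
rewrite mulgA conjgM -invgM; congr (_ ^ _).
suff: s j ^ (s j * s j.+1)^-1 = s j.+1 by rewrite conjMg => ->.
rewrite /conjg invgK; apply: (mulIg (s j * s j.+1)).
by rewrite -!mulgA mulVg mulg1 !mulgA braid_gen_braid //; lia.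
Qed.

Lemma pure_gen_down j : j.+1 < m -> A j.+1 ^ s j = A j.
Proof. by move=> jm; rewrite -(pure_gen_up jm) conjgKV. Qed.

(** The product winds strand m around strands j and j+1 together, and so is insensitive to their
    half twist s_j. Algebraically it is a conjugate of s_{j+1} s_j s_j s_{j+1}. The two remaining
    conjugation rules follow from it. *)
Lemma pure_gen_pair j : j.+1 < m -> (A j * A j.+1) ^ s j = A j * A j.+1.
Proof.
move=> jm; have tauC : (tau j.+2)^-1 * s j = s j * (tau j.+2)^-1.
  by rewrite (commuteV (strand_down_comm (ltnSn _) _)).
have -> : A j * A j.+1 = (s j.+1 * s j * s j * s j.+1) ^ (tau j.+2)^-1.
  rewrite !pure_genE strand_downS // invgM conjgM -conjMg; congr (_ ^ _).
  by rewrite /conjg invgK !mulgA mulgVK.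
rewrite -conjgM tauC conjgM; congr (_ ^ _); apply: conjg_fixed.
have bb := @braid_gen_braid n j; rewrite /commute !mulgA.
rewrite bb; last by lia.
rewrite -!mulgA; congr (_ * (_ * _)); rewrite !mulgA.
by rewrite bb //; lia.
Qed.

Lemma pure_gen_top_down j : j.+1 < m -> A j ^ s j = A j.+1 ^ (A j)^-1.
Proof.
move=> jm; have := pure_gen_pair jm; rewrite conjMg pure_gen_down // => h.
by apply: (mulIg (A j)); rewrite h; exact: conjgCV.
Qed.

Lemma pure_gen_top_up j : j.+1 < m -> A j.+1 ^ (s j)^-1 = A j ^ A j.+1.
Proof.
move=> jm; have := conjg_fixedV (pure_gen_pair jm).
rewrite conjMg pure_gen_up // => h.
by apply: (mulgI (A j.+1)); rewrite h; exact: conjgC.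
Qed.

Definition fiber_gen j : B := if j < m then A j else 1.
(** The image is the subgroup U of the combing. The domain is F_n rather than F_m, so that spelling
    words and conjugating elements live in one group. *)
Definition fiber : F -> B := free_hom fiber_gen.
HB.instance Definition _ := UMagmaMorphism.copy fiber (free_hom fiber_gen).
Definition in_fiber b := exists a, b = fiber a.

Lemma in_fiber1 : in_fiber 1.
Proof. by exists 1; rewrite gmulf1. Qed.
Lemma in_fiberM a b : in_fiber a -> in_fiber b -> in_fiber (a * b).
Proof. by move=> [a' ->] [b' ->]; exists (a' * b'); rewrite gmulfM. Qed.
Lemma in_fiberV a : in_fiber a -> in_fiber a^-1.
Proof. by move=> [a' ->]; exists a'^-1; rewrite gmulfV. Qed.
Lemma in_fiberJ a b : in_fiber a -> in_fiber b -> in_fiber (a ^ b).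
Proof. by move=> fa fb; do !apply: in_fiberM => //; apply: in_fiberV. Qed.
Lemma in_fiber_pure j : j < m -> in_fiber (A j).
Proof.
move=> jm; exists (x j); rewrite /fiber free_homE ?(ltn_trans jm) //.
by rewrite /fiber_gen jm.
Qed.

Lemma in_fiber_conj y : (forall j, j < m -> in_fiber (A j ^ y)) ->
  forall b, in_fiber b -> in_fiber (b ^ y).
Proof.
move=> Ay b [a ->]; have gy j : j < n -> in_fiber (fiber (x j) ^ y).
  move=> jn; rewrite /fiber free_homE // /fiber_gen.
  by case: ifP => [/Ay//|_]; rewrite conj1g; apply: in_fiber1.
elim/free_ind: a => [|i a i_n IH|i a i_n IH].
- by rewrite gmulf1 conj1g; apply: in_fiber1.
- by rewrite gmulfM conjMg; apply: in_fiberM => //; apply: gy.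
- rewrite gmulfM gmulfV conjMg conjVg; apply: in_fiberM => //.
  exact/in_fiberV/gy.
Qed.

(** Together with its inverse version, this says that braids on the first m strands normalize U,
    which lets combing move their generators to the left of u. *)
Lemma in_fiber_gen_conj i b : i.+1 < m -> in_fiber b -> in_fiber (b ^ s i).
Proof.
move=> im; apply: in_fiber_conj => j jm; have [->|ij] := eqVneq j i.
  by rewrite pure_gen_top_down //; apply: in_fiberJ;
    [|apply: in_fiberV]; apply: in_fiber_pure; lia.
have [->|i1j] := eqVneq j i.+1.
  by rewrite pure_gen_down //; apply: in_fiber_pure; lia.
by rewrite pure_gen_fixed //; first apply: in_fiber_pure; lia.
Qed.

Lemma in_fiber_gen_conjV i b : i.+1 < m -> in_fiber b ->
  in_fiber (b ^ (s i)^-1).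
Proof.
move=> im; apply: in_fiber_conj => j jm; have [->|ij] := eqVneq j i.
  by rewrite pure_gen_up //; apply: in_fiber_pure; lia.
have [->|i1j] := eqVneq j i.+1.
  by rewrite pure_gen_top_up //; apply: in_fiberJ; apply: in_fiber_pure; lia.
by rewrite conjg_fixedV ?pure_gen_fixed //; first apply: in_fiber_pure; lia.
Qed.

End Combing.

(** * The combing normal form *)

Section SubBraid.
Local Open Scope group_scope.
Variable n : nat.
Local Notation F := (free_group n).
Local Notation B := (braid_group n).
Local Notation s := (@braid_gen n).

(** The image of B_k, as a predicate on B_n. Words grow on the right because combing multiplies on
    the right. *)
Inductive sub_braid (k : nat) : B -> Prop :=
| sub_braid1 : sub_braid k 1
| sub_braidM b i : i.+1 < k -> sub_braid k b -> sub_braid k (b * s i)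
| sub_braidV b i : i.+1 < k -> sub_braid k b -> sub_braid k (b * (s i)^-1).

Lemma sub_braid_full b : sub_braid n b.
Proof.
suff {b} mulP b a : sub_braid n a -> sub_braid n (a * b).
  by rewrite -[b]mul1g; apply/mulP/sub_braid1.
elim/presented_ind: b a => [|i b IHb|i b IHb] a ha.
- by rewrite mulg1.
- rewrite mulgA; apply: IHb; rewrite -braid_gen_ord; apply: sub_braidM => //.
  by have := ltn_ord i; lia.
- rewrite mulgA; apply: IHb; rewrite -braid_gen_ord; apply: sub_braidV => //.
  by have := ltn_ord i; lia.
Qed.

Variable m : nat.
Hypothesis m_lt_n : m < n.
Local Notation tau := (strand_down n m).

(** The set of products h u tau_k is stable under right multiplication by s_i: tau_k s_i is s_{i-1}
    tau_k if i > k, A_k tau_{k+1} if i = k, tau_{k-1} if i = k - 1, and s_i tau_k if i < k - 1. A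
    letter s_{i-1} or s_i on the left of tau_k then crosses u into h. *)
Lemma combing b : sub_braid m.+1 b -> exists h u k,
  [/\ sub_braid m h, in_fiber m u, k <= m & b = h * u * tau k].
Proof.
elim=> {b} [|b i im _ [h [u [k [hh hu km ->]]]]|b i im _ [h [u [k [hh hu km
  ->]]]]].
- exists 1, 1, m; split=> //; [exact: sub_braid1|exact: in_fiber1|].
  by rewrite strand_down_top !mulg1.
- have [ltik|leki] := ltnP i k; last first.
    have [<-|neqki] := eqVneq k i.
      exists h, (u * pure_gen n m k), k.+1; split=> //; try lia.
        by apply: in_fiberM => //; apply: in_fiber_pure; lia.
      by rewrite -!mulgA pure_gen_tau //; lia.
    have ki : k <= i.-1 by lia.
    exists (h * s i.-1), (u ^ s i.-1), k; split=> //.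
    + by apply: sub_braidM => //; lia.
    + by apply: in_fiber_gen_conj => //; lia.
    rewrite /conjg !mulgA mulgK -!mulgA -strand_down_shift //; try lia.
    by rewrite prednK //; lia.
  have [ik|ik] := eqVneq k i.+1.
    exists h, u, i; split=> //; first by lia.
    by rewrite ik -mulgA -strand_downS //; lia.
  exists (h * s i), (u ^ s i), k; split=> //.
  + by apply: sub_braidM => //; lia.
  + by apply: in_fiber_gen_conj => //; lia.
  by rewrite /conjg !mulgA mulgK -!mulgA strand_down_comm //; lia.
(* For s_i^-1 the special cases trade places: i = k merely shortens tau_k, and i = k - 1 produces
   the inverse of A_i. *)
- have [ltik|leki] := ltnP i k; last first.
    have [<-|neqki] := eqVneq k i.
      exists h, u, k.+1; split=> //; try lia.
      by rewrite strand_downS ?mulgA ?mulgK //; lia.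
    have ki : k <= i.-1 by lia.
    exists (h * (s i.-1)^-1), (u ^ (s i.-1)^-1), k; split=> //.
    + by apply: sub_braidV => //; lia.
    + by apply: in_fiber_gen_conjV => //; lia.
    rewrite /conjg !mulgA mulgK -!mulgA; congr (_ * (_ * _)).
    apply: (mulgI (s i.-1)); rewrite mulVKg mulgA -strand_down_shift //;
      try lia.
    by rewrite prednK ?mulgK //; lia.
  have [ik|ik] := eqVneq k i.+1.
    exists h, (u * (pure_gen n m i)^-1), i; split=> //; last 2 first.
    + by lia.
    + rewrite ik -!mulgA; congr (_ * (_ * _)); apply: (mulgI (pure_gen n m i)).
      by rewrite mulVKg mulgA pure_gen_tau ?mulgK //; lia.
    by apply: in_fiberM => //; apply/in_fiberV/in_fiber_pure; lia.
  exists (h * (s i)^-1), (u ^ (s i)^-1), k; split=> //.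
  + by apply: sub_braidV => //; lia.
  + by apply: in_fiber_gen_conjV => //; lia.
  rewrite /conjg !mulgA mulgK -!mulgA; congr (_ * (_ * _)).
  by apply: commuteV; apply/commute_sym/strand_down_comm => //; lia.
Qed.
End SubBraid.

(** * Faithfulness of the Artin action *)

Section FreeGroupTruncation.
Local Open Scope group_scope.
Variables (n m : nat).
Local Notation F := (free_group n).
Local Notation x := (@free_gen n).

(** Kept as an endomorphism of F_n, so that it can be compared with the braid action on the same
    group. *)
Definition trunc : F -> F := free_hom (fun j => if j < m then x j else 1).
HB.instance Definition _ := UMagmaMorphism.copy trunc
  (free_hom (fun j => if j < m then x j else 1)).

Lemma truncM : {morph trunc : a b / a * b}. Proof. exact: gmulfM. Qed.
Lemma truncV : {morph trunc : a / a^-1}. Proof. exact: gmulfV. Qed.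
Lemma truncJ : {morph trunc : a b / a ^ b}. Proof. exact: gmulfJ. Qed.
Lemma trunc1 : trunc 1 = 1. Proof. exact: gmulf1. Qed.

Lemma trunc_lo j : j < m -> trunc (x j) = x j.
Proof.
move=> jm; have [jn|/free_gen_out->] := ltnP j n; last exact: trunc1.
by rewrite /trunc free_homE // jm.
Qed.

Lemma trunc_hi j : m <= j -> trunc (x j) = 1.
Proof.
move=> mj; have [jn|/free_gen_out->] := ltnP j n; last exact: trunc1.
by rewrite /trunc free_homE // ltnNge mj.
Qed.

(* The wreath product of Z/2 by the free group on the first m generators, as
   acting on the disjoint union of two copies of that group: the generator m
   exchanges the two copies of 1. *)
Definition wreath_letter (l : 'I_n * bool) (q : F * bool) : F * bool :=
  if l.1 == m :> nat then (q.1, q.2 (+) (q.1 == 1))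
  else if l.1 < m then (word_letter (fun j : 'I_n => x j) l * q.1, q.2) else q.

Lemma wreath_letterK j b : cancel (wreath_letter (j, ~~ b)) (wreath_letter (j,
  b)).
Proof.
move=> [g c]; rewrite /wreath_letter /=; case: eqP => _ /=.
  by rewrite -addbA addbb addbF.
by case: ltnP => // _; rewrite /word_letter; case: b; rewrite /= ?mulKg ?mulVKg.
Qed.

Definition wreath_act : F -> F * bool ->
  F * bool := presented_act wreath_letter.

Lemma wreath_actM a b q : wreath_act (a * b) q = wreath_act a (wreath_act b q).
Proof. by apply: presented_actM => //; apply: wreath_letterK. Qed.

Lemma wreath_act_gen j q : j < n ->
  wreath_act (x j) q = if j == m then (q.1, q.2 (+) (q.1 == 1))
                       else if j < m then (x j * q.1, q.2) else q.
Proof.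
move=> jn; rewrite [x j](free_gen_ord (Ordinal jn)) /wreath_act.
rewrite (presented_act_gen wreath_letterK) // /wreath_letter /= /word_letter /=.
by rewrite (free_gen_ord (Ordinal jn)).
Qed.

Lemma wreath_act_genV j q : j < n ->
  wreath_act (x j)^-1 q = if j == m then (q.1, q.2 (+) (q.1 == 1))
                          else if j < m then ((x j)^-1 * q.1, q.2) else q.
Proof.
move=> jn; rewrite [x j](free_gen_ord (Ordinal jn)) /wreath_act.
rewrite (presented_act_genV wreath_letterK) // /wreath_letter /= /word_letter
  /=.
by rewrite (free_gen_ord (Ordinal jn)).
Qed.

Lemma wreath_act_fst a q : (wreath_act a q).1 = trunc a * q.1.
Proof.
elim/free_ind: a => [|j a jn IH|j a jn IH].
- by rewrite trunc1 mul1g /wreath_act (presented_act1 wreath_letterK).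
- rewrite wreath_actM wreath_act_gen // truncM -mulgA -IH.
  have [ltjm|ltmj|->] /= := ltngtP j m; first by rewrite trunc_lo.
    by rewrite trunc_hi ?mul1g // ltnW.
  by rewrite trunc_hi ?mul1g.
- rewrite wreath_actM wreath_act_genV // truncM truncV -mulgA -IH.
  have [ltjm|ltmj|->] /= := ltngtP j m; first by rewrite trunc_lo.
    by rewrite trunc_hi ?invg1 ?mul1g // ltnW.
  by rewrite trunc_hi ?invg1 ?mul1g.
Qed.

Lemma free_gen_neq1 : m < n -> x m != 1.
Proof.
move=> mn; apply/eqP => xm1; have := wreath_act_gen (1, false) mn.
by rewrite xm1 /wreath_act (presented_act1 wreath_letterK) // eqxx /= eqxx.
Qed.

(** Apply x_m c = c x_m to the point ((trunc c)^-1, false). On the left, c brings it over 1, where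
    x_m exchanges the copies; on the right, x_m leaves it alone unless trunc c = 1. The second
    components would then differ. *)
Lemma trunc_centralizer c : m < n -> x m ^ c = x m -> trunc c = 1.
Proof.
move=> mn xmc; have xmcC : x m * c = c * x m by rewrite conjgC xmc.
apply/eqP/negP => /negP c1.
have /(congr1 snd) := congr1 (wreath_act ^~ ((trunc c)^-1, false)) xmcC.
rewrite !wreath_actM !wreath_act_gen // eqxx /= invg_eq1 (negPf c1) /=.
by rewrite wreath_act_fst /= mulgV eqxx addbT; case: (_.2).
Qed.

End FreeGroupTruncation.

(** * Point pushing and Artin's theorem *)

Section ArtinFaithful.
Local Open Scope group_scope.
Variable n : nat.
Local Notation F := (free_group n).
Local Notation B := (braid_group n).
Local Notation s := (@braid_gen n).
Local Notation x := (@free_gen n).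
Local Notation t := (@artin_gen n).

Local Notation artin := (@artin n).

Lemma artinM a b y : artin (a * b) y = artin a (artin b y).
Proof. by have -> : artin (a * b) = artin a * artin b by exact: gmulfM. Qed.

Lemma artin1 y : artin 1 y = y.
Proof. by have -> : artin 1 = 1 by exact: gmulf1. Qed.

Lemma artinV (a : B) y : artin a^-1 y = (artin a)^-1 y.
Proof. by have -> : artin a^-1 = (artin a)^-1 by exact: gmulfV. Qed.

Lemma artinK (b : B) : cancel (artin b) (artin b^-1).
Proof. by move=> y; rewrite -artinM mulVg artin1. Qed.

Lemma artinKV (b : B) : cancel (artin b^-1) (artin b).
Proof. by move=> y; rewrite -artinM mulgV artin1. Qed.

Section Strand.
Variable m : nat.
Hypothesis m_lt_n : m < n.
Local Notation p := (@trunc n m).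

Lemma artin_gen_trunc i a : i.+1 < m -> p (t i a) = t i (p a).
Proof.
move=> im; rewrite -[LHS]/((p \o t i) a) -[RHS]/((t i \o p) a).
apply: free_hom_ext => j jn.
rewrite -[LHS]/(p (t i (x j))) -[RHS]/(t i (p (x j))).
have [->|ji] := eqVneq j i.
  by rewrite artin_gen_l ?(@trunc_lo n m i) ?artin_gen_l ?trunc_lo //; lia.
have [->|ji1] := eqVneq j i.+1.
  rewrite artin_gen_r ?(@trunc_lo n m i.+1) ?artin_gen_r ?truncJ; try lia.
  by rewrite !trunc_lo //; lia.
rewrite artin_gen_id //; have [jm|mj] := ltnP j m.
  by rewrite trunc_lo // artin_gen_id.
by rewrite trunc_hi // group_aut1.
Qed.

Lemma artin_genV_trunc i a : i.+1 < m -> p ((t i)^-1 a) = (t i)^-1 (p a).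
Proof.
move=> im; apply: (canRL (group_aut_invK _)); rewrite -artin_gen_trunc //.
by rewrite group_aut_Kinv.
Qed.

Lemma sub_braid_trunc h a : sub_braid m h -> p (artin h a) = artin h (p a).
Proof.
move=> hh; elim: hh a => {h} [|h i im _ IH|h i im _ IH] a.
- by rewrite !artin1.
- by rewrite !artinM IH artinE artin_gen_trunc.
- by rewrite !artinM IH !artinV artinE artin_genV_trunc.
Qed.

Lemma artin_genV_hi i j : i.+1 < m -> m <= j -> (t i)^-1 (x j) = x j.
Proof.
by move=> im mj; apply: (canLR (group_aut_invK _)); rewrite artin_gen_id //;
  lia.
Qed.

Lemma sub_braid_hi h j : sub_braid m h -> m <= j -> artin h (x j) = x j.
Proof.
move=> hh mj; elim: hh => {h} [|h i im _ IH|h i im _ IH].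
- by rewrite artin1.
- by rewrite artinM artinE artin_gen_id //; lia.
- by rewrite artinM artinV artinE artin_genV_hi.
Qed.

(* The braid b pushes strand m along the loop y of the plane punctured at the
   first m strands. *)
Definition point_push (b : B) (y : F) :=
  (forall a, p (artin b a) = p a) /\
  exists2 c, artin b (x m) = x m ^ c & p c = y.

Lemma point_push1 : point_push 1 1.
Proof.
split=> [a|]; first by rewrite artin1.
by exists 1; rewrite ?artin1 ?conjg1 ?trunc1.
Qed.

Lemma point_pushM a b y z :
  point_push a y -> point_push b z -> point_push (a * b) (y * z).
Proof.
move=> [pa [ca aE <-]] [pb [cb bE <-]]; split=> [e|].
  by rewrite artinM pa pb.
(* Conjugating elements multiply as a cocycle, and [p] erases the twist by [artin a]. *)
exists (ca * artin a cb); last by rewrite truncM pa.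
by rewrite artinM bE group_autJ aE conjgM.
Qed.

Lemma point_pushV b y : point_push b y -> point_push b^-1 y^-1.
Proof.
move=> [pb [c bE <-]]; split=> [a|]; first by rewrite -pb artinKV.
exists (artin b^-1 c)^-1; last by rewrite truncV -[in LHS]pb artinKV.
apply: (canRL (conjgK _)); rewrite -group_autJ -bE; exact: artinK.
Qed.

Lemma point_push_top : 0 < m -> point_push (s m.-1 * s m.-1) (x m.-1).
Proof.
move=> m0; have Em : m = m.-1.+1 by lia.
have m1n : m.-1.+1 < n by lia.
have sE y : artin (s m.-1 * s m.-1) y = t m.-1 (t m.-1 y).
  by rewrite artinM artinE.
have tr := artin_gen_r m1n; have tl := artin_gen_l m1n.
have px : p (x m.-1.+1) = 1 by rewrite trunc_hi //; lia.
have px' : p (x m.-1) = x m.-1 by rewrite trunc_lo //; lia.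
rewrite -Em in tr tl px; split=> [a|].
  rewrite sE -[LHS]/((p \o (t m.-1 \o t m.-1)) a).
  apply: free_hom_ext => j jn.
  rewrite -[LHS]/(p (t m.-1 (t m.-1 (x j)))).
  have [->|jm1] := eqVneq j m.-1; first by rewrite tl tr truncJ px px' conjg1.
  have [->|jm] := eqVneq j m.
    by rewrite tr group_autJ tl tr !truncJ px conj1g.
  by rewrite !artin_gen_id //; lia.
exists (x m.-1 ^ x m); last by rewrite truncJ px px' conjg1.
by rewrite sE tr group_autJ tl tr.
Qed.

(** The generator s_i with i + 1 < m fixes x_m and commutes with [p], so it only transports the
    loop. *)
Lemma point_push_conj i b y : i.+1 < m -> point_push b y ->
  point_push (b ^ s i) ((t i)^-1 y).
Proof.
move=> im [pb [c bE <-]].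
have bsE a : artin (b ^ s i) a = (t i)^-1 (artin b (t i a)).
  by rewrite /conjg !artinM artinV artinE.
split=> [a|].
  by rewrite bsE artin_genV_trunc // pb artin_gen_trunc // group_aut_invK.
exists ((t i)^-1 c); last by rewrite artin_genV_trunc.
rewrite bsE artin_gen_id ?bE; try lia.
by rewrite group_autJ artin_genV_hi.
Qed.

(** Descending from A_{m-1}, the square of s_{m-1}, by A_j = A_{j+1} ^ s_j. *)
Lemma point_push_pure j : j < m -> point_push (pure_gen n m j) (x j).
Proof.
move=> jm; have m0 : 0 < m by lia.
have jm1 : j <= m.-1 by lia.
pose P j := point_push (pure_gen n m j) (x j).
apply: (@descending_ind m.-1 P) jm1 => {j jm} [|j jm IH]; rewrite /P.
  rewrite pure_genE prednK // strand_down_top invg1 conjg1.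
  exact: point_push_top.
have j1m : j.+1 < m by lia.
rewrite -pure_gen_down // (_ : x j = (t j)^-1 (x j.+1)).
  exact: point_push_conj.
by apply: (canRL (group_aut_invK _)); rewrite artin_gen_l //; lia.
Qed.

(** Multiplicative extension from the generators. It recovers from the action on x_m the word that
    spells an element of U. *)
Lemma point_push_fiber a : point_push (fiber m a) (p a).
Proof.
have pg j : j < n -> point_push (fiber m (x j)) (p (x j)).
  move=> jn; rewrite /fiber free_homE // /fiber_gen.
  have [jm|mj] := ltnP j m; first by rewrite trunc_lo //;
    apply: point_push_pure.
  by rewrite trunc_hi //; apply: point_push1.
elim/free_ind: a => [|j a jn IH|j a jn IH].
- by rewrite trunc1 gmulf1; apply: point_push1.
- by rewrite truncM gmulfM; apply: point_pushM => //; apply: pg.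
- rewrite truncM truncV gmulfM gmulfV; apply: point_pushM => //.
  exact/point_pushV/pg.
Qed.

Lemma fiber_trunc a : fiber m (p a) = fiber m a.
Proof.
rewrite -[LHS]/((fiber m \o p) a); apply: free_hom_ext => j jn.
rewrite -[LHS]/(fiber m (p (x j))) -[RHS]/(fiber m (x j)).
have [jm|mj] := ltnP j m; first by rewrite trunc_lo.
by rewrite trunc_hi // gmulf1 /fiber free_homE // /fiber_gen ltnNge mj.
Qed.

Lemma artin_strand_down k : k <= m -> artin (strand_down n m k) (x k) = x m.
Proof.
pose P k := artin (strand_down n m k) (x k) = x m.
apply: (@descending_ind m P) => {k} [|k km IH]; rewrite /P.
  by rewrite strand_down_top artin1.
by rewrite strand_downS // artinM artinE artin_gen_l //; lia.
Qed.

Lemma artin_combing_trivial b : sub_braid m.+1 b -> artin b = 1 ->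
  (forall h, sub_braid m h -> artin h = 1 -> h = 1) -> b = 1.
Proof.
move=> hb b1 faithful; have [h [u [k [hh [a uE] km bE]]]] := combing m_lt_n hb.
have [pu [c uxm pc]] := point_push_fiber a; rewrite -uE in pu uxm.
have bE' y : artin h (artin u (artin (strand_down n m k) y)) = y.
  by rewrite -!artinM -bE b1.
(* If k < m, then b sends x_k to a conjugate of x_m, which [p] kills; but b fixes x_k, and [p] does
   not kill it. *)
have km' : k = m.
  apply/eqP; rewrite eqn_leq km leqNgt; apply/negP => ltkm.
  have := bE' (x k); rewrite artin_strand_down // uxm group_autJ.
  rewrite (sub_braid_hi hh) // => /(congr1 p).
  rewrite truncJ trunc_hi // conj1g trunc_lo // => /esym/eqP.
  by apply/negP; apply: free_gen_neq1; apply: ltn_trans m_lt_n.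
have {}bE' y : artin h (artin u y) = y.
  by have := bE' y; rewrite km' strand_down_top artin1.
(* Apply [p] to the identity h u = 1 on x_j: u disappears, and h commutes with [p]. *)
have h1 : h = 1.
  apply: faithful => //; apply: free_aut_ext => j jn.
  rewrite -[RHS]/(x j); have [jm|mj] := ltnP j m; last exact: sub_braid_hi hh _.
  rewrite -{1}(trunc_lo n jm) -pu -(sub_braid_trunc _ hh) bE'.
  exact: trunc_lo.
move: uxm; have -> : artin u (x m) = x m by rewrite -[RHS]bE' h1 artin1.
(* Now u fixes x_m, so c centralizes x_m and p c = p a is trivial. *)
move=> /esym/(trunc_centralizer m_lt_n) pc1.
rewrite bE km' strand_down_top h1 mulg1 mul1g uE -fiber_trunc.
by rewrite -pc pc1 gmulf1.
Qed.

End Strand.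

Lemma artin_faithful : injective artin.
Proof.
suff faithful m (b : B) : m <= n -> sub_braid m b -> artin b = 1 -> b = 1.
  by apply: gmulf_inj => b; apply: (faithful n) => //; apply: sub_braid_full.
elim: m b => [|m IHm] b mn hb b1; first by case: hb => // ? ? //.
apply: (artin_combing_trivial mn hb b1) => h hh; apply: IHm hh; exact: ltnW.
Qed.

End ArtinFaithful.

(** * Free matrices in SL_2 *)

Section TwoByTwo.
Local Open Scope ring_scope.
Variable R : comNzRingType.
Implicit Types A B : 'M[R]_2.

Lemma ord2P (i : 'I_2) : i = 0 \/ i = 1.
Proof. by case: i => [[|[]]] //= ?; [left|right]; apply: val_inj. Qed.

Lemma mx2_eq A B : A 0 0 = B 0 0 -> A 0 1 = B 0 1 ->
  A 1 0 = B 1 0 -> A 1 1 = B 1 1 -> A = B.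
Proof.
by move=> ? ? ? ?; apply/matrixP => i j; case: (ord2P i) (ord2P j) => -> [] ->.
Qed.

Lemma mul2E A B i j : (A * B) i j = A i 0 * B 0 j + A i 1 * B 1 j.
Proof. by rewrite [LHS]mxE !big_ord_recl big_ord0 addr0;
  congr (_ + A i _ * B _ j); apply: val_inj. Qed.

Definition mx2 (a b c d : R) : 'M[R]_2 :=
  \matrix_(i, j) if i == 0 then if j == 0 then a else b
                 else if j == 0 then c else d.

Lemma mx2E a b c d : (mx2 a b c d 0 0 = a) * (mx2 a b c d 0 1 = b) *
  (mx2 a b c d 1 0 = c) * (mx2 a b c d 1 1 = d).
Proof. by rewrite !mxE. Qed.

(** On SL_2 this is the inverse. It has no denominators, so specialization respects it. *)
Definition adj2 A := mx2 (A 1 1) (- A 0 1) (- A 1 0) (A 0 0).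
Definition sl2 A := A 0 0 * A 1 1 - A 0 1 * A 1 0 = 1.

Lemma one2E : ((1 : 'M[R]_2) 0 0 = 1) * ((1 : 'M[R]_2) 0 1 = 0) *
  ((1 : 'M[R]_2) 1 0 = 0) * ((1 : 'M[R]_2) 1 1 = 1).
Proof. by rewrite !mxE. Qed.

Lemma mul2_adj A : sl2 A -> A * adj2 A = 1.
Proof.
by rewrite /sl2 => A1; apply: mx2_eq; rewrite mul2E !mx2E one2E -?A1; ring.
Qed.

Lemma adj2_mul A : sl2 A -> adj2 A * A = 1.
Proof.
by rewrite /sl2 => A1; apply: mx2_eq; rewrite mul2E !mx2E one2E -?A1; ring.
Qed.

Lemma sl2_1 : sl2 1.
Proof. by rewrite /sl2 !one2E; ring. Qed.

Lemma sl2M A B : sl2 A -> sl2 B -> sl2 (A * B).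
Proof.
rewrite /sl2 => A1 B1; rewrite !mul2E -[RHS]mulr1 -{1}A1 -B1; ring.
Qed.

Lemma sl2_adj A : sl2 A -> sl2 (adj2 A).
Proof. by rewrite /sl2 !mx2E => <-; ring. Qed.

End TwoByTwo.

(** * Words evaluated at matrices of determinant 1 *)

Section MatrixWords.
Local Open Scope ring_scope.
Variables (R : comNzRingType) (s : nat).
Local Notation F := (free_group s).
Implicit Types M : 'I_s -> 'M[R]_2.

Definition sl2_letter M (p : 'I_s * bool) :=
  if p.2 then M p.1 else adj2 (M p.1).
Definition sl2_word M (w : seq ('I_s * bool)) := \prod_(p <- w) sl2_letter M p.
Definition sl2_val M (a : F) := sl2_word M (repr a).

Variable M : 'I_s -> 'M[R]_2.
Hypothesis M1 : forall i, sl2 (M i).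

Lemma sl2_letter_sl2 p : sl2 (sl2_letter M p).
Proof. by rewrite /sl2_letter; case: ifP => // _; apply: sl2_adj. Qed.

Lemma sl2_word_sl2 w : sl2 (sl2_word M w).
Proof.
rewrite /sl2_word; elim: w => [|p w IHw]; first by rewrite big_nil;
  apply: sl2_1.
by rewrite big_cons; apply: sl2M => //; apply: sl2_letter_sl2.
Qed.

Lemma sl2_val_sl2 a : sl2 (sl2_val M a). Proof. exact: sl2_word_sl2. Qed.

Lemma sl2_word_eq u v :
  word_eq (fun _ _ => False) u v -> sl2_word M u = sl2_word M v.
Proof.
move=> uv; pose f p (A : 'M[R]_2) := sl2_letter M p * A.
have fE w A : foldr f A w = sl2_word M w * A.
  rewrite /sl2_word; elim: w => [|p w IHw] /=; first by rewrite big_nil mul1r.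
  by rewrite IHw big_cons /f mulrA.
have fK x b : cancel (f (x, ~~ b)) (f (x, b)).
  move=> A; rewrite /f mulrA /sl2_letter.
  by case: b; rewrite /= ?mul2_adj ?adj2_mul ?mul1r.
by have := foldr_word_eq fK (fun _ _ => @False_ind _) uv 1; rewrite !fE !mulr1.
Qed.

Lemma sl2_val_pi w : sl2_val M (\pi_F w)%qT = sl2_word M w.
Proof. exact/sl2_word_eq/word_eq_repr. Qed.

Lemma sl2_val1 : sl2_val M 1%g = 1.
Proof. by rewrite -[1%g]/(\pi_F [::])%qT sl2_val_pi /sl2_word big_nil. Qed.

Lemma sl2_valM a b : sl2_val M (a * b)%g = sl2_val M a * sl2_val M b.
Proof.
by rewrite -[a in LHS]reprK -[b in LHS]reprK presented_piM sl2_val_pi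
  /sl2_word big_cat.
Qed.

Lemma sl2_val_gen (i : 'I_s) : sl2_val M (presented_gen _ i) = M i.
Proof. by rewrite sl2_val_pi /sl2_word big_seq1. Qed.

Lemma sl2_valV a : sl2_val M a^-1%g = adj2 (sl2_val M a).
Proof.
rewrite -[LHS]mulr1 -(mul2_adj (sl2_val_sl2 a)) mulrA -sl2_valM mulVg sl2_val1.
exact: mul1r.
Qed.

End MatrixWords.

(** Both sides are the representation of F_s given by M, precomposed with f; they agree on
    generators. *)
Lemma sl2_val_subst (R : comNzRingType) (s : nat) (M : 'I_s -> 'M[R]_2)
    (f : group_aut (free_group s)) a :
    (forall i, sl2 (M i)) ->
  sl2_val (fun i => sl2_val M (f (presented_gen _ i))) a = sl2_val M (f a).
Proof.
move=> M1; have fM1 i : sl2 (sl2_val M (f (presented_gen _ i))).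
  exact: sl2_val_sl2.
elim/presented_ind: a => [|i a IHa|i a IHa].
- by rewrite group_aut1 !sl2_val1.
- by rewrite group_autM !sl2_valM // IHa sl2_val_gen.
- by rewrite group_autM group_autV !sl2_valM // !sl2_valV // IHa sl2_val_gen.
Qed.

Section ReducedWords.
Variable X : choiceType.
Implicit Types (p q : X * bool) (w : seq (X * bool)).

Definition reduced w := sorted (fun p q => q != (p.1, ~~ p.2)) w.

(** Letters are prepended one at a time, each cancelling the head of the reduced tail if that head
    is its inverse. *)
Lemma reduced_repr w :
  exists2 w', word_eq (fun _ _ => False) w w' & reduced w'.
Proof.
elim: w => [|[x b] u [u' uu' ru']]; first by exists [::] => //;
  apply: word_eq_refl.
have xu : word_eq (fun _ _ => False) ((x, b) :: u) ((x, b) :: u').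
  by rewrite -cat1s -(cat1s _ u'); apply: word_eq_cat => //;
    apply: word_eq_refl.
case: u' => [|q u'] in uu' ru' xu *; first by exists [:: (x, b)].
have [qE|qN] := eqVneq q (x, ~~ b); last first.
  by exists [:: (x, b), q & u'] => //=; rewrite qN.
exists u'; last exact: path_sorted ru'.
apply: word_eq_trans xu _; rewrite qE -[u' in X in word_eq _ _ X]cat0s.
rewrite -[_ :: _ :: _]/([:: (x, b); (x, ~~ b)] ++ u').
by apply: word_eq_cat; [apply: word_eq_cancel|apply: word_eq_refl].
Qed.

End ReducedWords.

(** Euclid's argument: a root of X times the product of the X - z, plus 1, differs from every z. *)
Lemma closed_field_uniq_seq (k : closedFieldType) n :
  exists zs : seq k, uniq zs /\ size zs = n.
Proof.
elim: n => [|n [zs [zsU zsn]]]; first by exists [::].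
pose g : {poly k} := (\prod_(z <- zs) ('X - z%:P))%R.
pose p : {poly k} := (g * 'X + 1)%R.
have p_size : size p != 1.
  rewrite /p size_MXaddC oner_eq0 andbF.
  by rewrite size_prod_XsubC.
have [z /rootP pz] := closed_rootP _ p_size.
exists (z :: zs); split; last by rewrite /= zsn.
rewrite /= zsU andbT; apply/negP => zzs; move/eqP: pz.
have gz : g.[z]%R = 0%R by apply/rootP; rewrite root_prod_XsubC.
by rewrite /p hornerD hornerM gz mul0r add0r hornerC oner_eq0.
Qed.

(** * Loxodromic matrices generating a free group *)

Section FreeMatrices.
Local Open Scope ring_scope.
Variables (k : fieldType) (s : nat) (z : 'I_s * bool -> k).
Hypothesis z_inj : injective z.
Implicit Type p : 'I_s * bool.

Definition flip p := (p.1, ~~ p.2).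

Lemma flipK : involutive flip.
Proof. by move=> [i b]; rewrite /flip /= negbK. Qed.

Lemma z_flip p : z p - z (flip p) != 0.
Proof.
rewrite subr_eq0 (inj_eq z_inj); case: p => i b.
by rewrite /flip xpair_eqE eqxx; case: b.
Qed.

(* The projection with image the line z p and kernel the line z (flip p). *)
Definition line_proj p : 'M[k]_2 :=
  let e := (z p - z (flip p))^-1 in
  mx2 (- z (flip p) * e) e (- z p * z (flip p) * e) (z p * e).

(** The last column of a product starting with p stays a nonzero multiple of (1, z p). Prepending p
    to a word starting with q scales its top entry by (z q - z (flip p)) / (z p - z (flip p)),
    nonzero because q is not [flip p]. *)
Lemma line_proj_reduced w : w != [::] -> reduced w ->
  \prod_(p <- w) line_proj p != 0.
Proof.
suff H p w' : path (fun p q => q != (p.1, ~~ p.2)) p w' ->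
    let A := \prod_(q <- p :: w') line_proj q in A 0 1 != 0 /\ A 1 1 =
      z p * A 0 1.
  case: w => // p w _ /H[/eqP w01 _]; apply/eqP => w0.
  by apply: w01; rewrite w0 mxE.
elim: w' p => [|q w' IHw] p /=.
  by rewrite big_seq1 !mx2E invr_eq0 z_flip.
move=> /andP[qp /IHw /=]; rewrite (big_cons _ _ p) !mul2E.
move: (\prod_(_ <- _) _) => A [A0 ->]; rewrite !mx2E.
have zqp : z q - z (flip p) != 0 by rewrite subr_eq0 (inj_eq z_inj).
split; last by ring.
rewrite (_ : _ + _ = (z q - z (flip p)) / (z p - z (flip p)) * A 0 1);
  last by ring.
by rewrite !mulf_neq0 ?invr_eq0 ?z_flip.
Qed.

Local Notation L := {fraction {poly k}}.
Local Notation tofrac := (@FracField.tofrac {poly k}).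

(** This is X times [loxodromic p]: it has polynomial entries, and its value at X = 0 is the
    projection [line_proj p]. *)
Definition loxodromic_poly p : 'M[{poly k}]_2 :=
  map_mx polyC (line_proj p) + 'X ^+ 2 *: map_mx polyC (line_proj (flip p)).
(* Eigenvalues 1/X and X. *)
Definition loxodromic p : 'M[L]_2 :=
  (tofrac 'X)^-1 *: map_mx tofrac (loxodromic_poly p).

Lemma tofracX_neq0 : tofrac 'X != 0.
Proof. by rewrite tofrac_eq0 polyX_eq0. Qed.

Definition cst (c : k) : L := tofrac c%:P.
HB.instance Definition _ := GRing.RMorphism.copy cst (tofrac \o @polyC k).

Lemma loxodromicE p i j : loxodromic p i j =
  (tofrac 'X)^-1 * cst (line_proj p i j) + tofrac 'X * cst (line_proj (flip p)
    i j).
Proof.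
rewrite !mxE tofracD tofracM tofracXn -/(cst _) -/(cst _) mulrDr; congr (_ + _).
by rewrite mulrA expr2 mulrA mulVf ?tofracX_neq0 ?mul1r.
Qed.

(** The complementary projection 1 - P is tr P - P, the adjugate of P. *)
Lemma line_proj_flip p : line_proj (flip p) = adj2 (line_proj p).
Proof.
have e : (z (flip p) - z p)^-1 = - (z p - z (flip p))^-1.
  by rewrite -invrN opprB.
by apply: mx2_eq; rewrite !mx2E flipK e; ring.
Qed.

Lemma line_proj_det p :
  line_proj p 0 0 * line_proj p 1 1 = line_proj p 0 1 * line_proj p 1 0.
Proof. by rewrite !mx2E; ring. Qed.

Lemma line_proj_tr p : line_proj p 0 0 + line_proj p 1 1 = 1.
Proof. by rewrite !mx2E -mulrDl addrC mulfV ?z_flip. Qed.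

Lemma loxodromic_flip p : loxodromic (flip p) = adj2 (loxodromic p).
Proof.
by apply: mx2_eq; rewrite !mx2E !loxodromicE flipK line_proj_flip !mx2E
  ?rmorphN /=; ring.
Qed.

Lemma loxodromic_sl2 p : sl2 (loxodromic p).
Proof.
rewrite /sl2 !loxodromicE line_proj_flip.
have := congr1 cst (line_proj_det p); have := congr1 cst (line_proj_tr p).
move: (line_proj p) => A; rewrite !(rmorphM, rmorphD) !mx2E !rmorphN rmorph1 /=.
have := mulVf tofracX_neq0.
move: (tofrac 'X) (tofrac 'X)^-1 => t t' tt.
move: (cst (A 0 0)) (cst (A 0 1)) (cst (A 1 0)) (cst (A 1 1)) =>
  a b c d ad1 abcd.
(* The determinant of t' A + t adj A, in terms of the determinant and trace of A, which are here 0
   and 1. *)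
rewrite (_ : _ - _ = (a * d - b * c) * (t' ^+ 2 + t ^+ 2) +
  t' * t * ((a + d) ^+ 2 - 2%:R * (a * d - b * c))); last by ring.
by rewrite abcd ad1 tt; ring.
Qed.

(** It places the matrix in the chart of SL_2. Up to a factor, the entry is z p X^2 - z (flip p),
    and its two coefficients cannot both vanish as they are distinct. *)
Lemma loxodromic00_neq0 p : loxodromic p 0 0 != 0.
Proof.
rewrite loxodromicE line_proj_flip (mx2E (line_proj p 1 1)).
have -> a b : (tofrac 'X)^-1 * cst a + tofrac 'X * cst b =
    (tofrac 'X)^-1 * tofrac (a%:P + 'X ^+ 2 * b%:P).
  rewrite tofracD tofracM tofracXn mulrDr mulrA expr2 mulrA.
  by rewrite mulVf ?tofracX_neq0 ?mul1r.
rewrite mulf_eq0 invr_eq0 (negPf tofracX_neq0) tofrac_eq0.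
apply/eqP => /polyP e; have := e 0%N; have := e 2%N.
rewrite !coefD !coefXnM !coefC /= add0r addr0 !mx2E => /eqP a /eqP b.
move: a b; rewrite !mulf_eq0 invr_eq0 (negPf (z_flip p)) !orbF => /eqP a.
by rewrite oppr_eq0 => /eqP b; have := z_flip p; rewrite a b subrr eqxx.
Qed.

Lemma loxodromic_letter p :
  sl2_letter (fun i => loxodromic (i, true)) p = loxodromic p.
Proof.
by case: p => i [] //; rewrite /sl2_letter /= -loxodromic_flip.
Qed.

Lemma loxodromic_free w : w != [::] -> reduced w ->
  sl2_word (fun i => loxodromic (i, true)) w != 1.
Proof.
move=> w0 rw; apply: contraNneq (line_proj_reduced w0 rw) => w1.
have tofrac_inj : injective tofrac.
  by move=> a b /eqP; rewrite tofrac_eq => /eqP.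
(* Clearing denominators multiplies the word by X to the power of its length. *)
pose Q := \prod_(p <- w) loxodromic_poly p.
have QX : Q = 'X ^+ size w *: 1.
  suff /matrixP QX : map_mx tofrac Q = map_mx tofrac ('X ^+ size w *: 1).
    apply/matrixP => i j; apply: tofrac_inj; have := QX i j.
    by rewrite [LHS]mxE [RHS]mxE.
  rewrite map_mxZ /= tofracXn map_mx1 -/(1 : 'M[L]_2) -w1 /Q /sl2_word.
  elim: (w) => [|p u IHu]; first by rewrite !big_nil map_mx1 scale1r.
  rewrite !big_cons map_mxM IHu loxodromic_letter /=.
  rewrite (_ : map_mx _ _ = tofrac 'X *: loxodromic p); last first.
    by rewrite scalerA mulfV ?tofracX_neq0 ?scale1r.
  by rewrite exprS -scalemxAl -scalemxAr scalerA.
(* At X = 0 the power of X vanishes, as w is not empty, and Q becomes the product of the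
   projections. *)
have := congr1 (map_mx (horner_eval 0)) QX.
rewrite map_mxZ /= map_mx1 horner_evalE hornerXn expr0n size_eq0 (negPf w0)
  scale0r => <-.
apply/eqP; rewrite /Q; elim: (w) => [|p u IHu];
  first by rewrite !big_nil map_mx1.
rewrite !big_cons map_mxM -IHu; congr (_ *m _); apply/matrixP => i j.
rewrite [RHS]mxE /loxodromic_poly.
move: (line_proj p) (line_proj (flip p)) => A A'; rewrite !mxE /= horner_evalE.
by rewrite hornerD hornerM hornerXn hornerC expr0n mul0r addr0.
Qed.

End FreeMatrices.

(** * The action on generic matrices *)

Section Specialization.
Local Open Scope ring_scope.
Variables (k : fieldType) (r : nat) (L : fieldType).
Variable theta : {rmorphism {mpoly k[r]} -> L}.
Local Notation K := {fraction {mpoly k[r]}}.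
Local Notation tofrac := (@FracField.tofrac {mpoly k[r]}).

(* The rational function f is defined at the L-point theta, with value l. *)
Definition specializes (f : K) (l : L) : Prop :=
  exists p q, [/\ theta q != 0, f = tofrac p / tofrac q & l =
    theta p / theta q].

Lemma theta_neq0 q : theta q != 0 -> q != 0.
Proof. by apply: contraNneq => ->; rewrite rmorph0. Qed.

Lemma specializes_poly p : specializes (tofrac p) (theta p).
Proof. by exists p, 1; rewrite !rmorph1 !divr1 oner_neq0. Qed.

Lemma specializes0 : specializes 0 0.
Proof. by have := specializes_poly 0; rewrite !rmorph0. Qed.

Lemma specializes1 : specializes 1 1.
Proof. by have := specializes_poly 1; rewrite !rmorph1. Qed.

Lemma specializesD f g l m :
  specializes f l -> specializes g m -> specializes (f + g) (l + m).
Proof.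
move=> [p [q [q0 -> ->]]] [p' [q' [q'0 -> ->]]].
exists (p * q' + p' * q), (q * q'); rewrite rmorphM mulf_neq0 //; split=> //.
  by rewrite addf_div ?tofrac_eq0 ?theta_neq0 // !(tofracM, tofracD).
by rewrite addf_div // !(rmorphM, rmorphD).
Qed.

Lemma specializesM f g l m :
  specializes f l -> specializes g m -> specializes (f * g) (l * m).
Proof.
move=> [p [q [q0 -> ->]]] [p' [q' [q'0 -> ->]]].
exists (p * p'), (q * q'); rewrite rmorphM mulf_neq0 //; split=> //.
  by rewrite mulf_div !tofracM.
by rewrite mulf_div !rmorphM.
Qed.

Lemma specializesN f l : specializes f l -> specializes (- f) (- l).
Proof.
move=> [p [q [q0 -> ->]]]; exists (- p), q; split=> //.
  by rewrite tofracN mulNr.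
by rewrite rmorphN mulNr.
Qed.

Lemma specializesV f l : l != 0 -> specializes f l -> specializes f^-1 l^-1.
Proof.
move=> l0 [p [q [q0 -> lE]]]; exists q, p; split; rewrite ?lE ?invf_div //.
by apply: contraNneq l0 => p0; rewrite lE p0 mul0r.
Qed.

Lemma specializes_uniq f l m : specializes f l -> specializes f m -> l = m.
Proof.
move=> [p [q [q0 -> ->]]] [p' [q' [q'0 /eqP]]].
rewrite eqr_div ?tofrac_eq0 ?theta_neq0 // -!tofracM tofrac_eq => /eqP e ->.
by apply/eqP; rewrite eqr_div // -!rmorphM e.
Qed.

Lemma specializes_mmap (phi : 'I_r -> K) (y : 'I_r ->
  L) (iota : {rmorphism k -> L}) p :
    (forall c, theta c%:MP = iota c) -> (forall j, specializes (phi j) (y j)) ->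
  specializes (mmap (@ratconst k r) phi p) (mmap iota y p).
Proof.
move=> thetaC phiy; rewrite /mmap.
elim/big_rec2: _ => [|m l f _ fl]; first exact: specializes0.
apply: specializesD fl; apply: specializesM.
  by rewrite /ratconst -thetaC; apply: specializes_poly.
rewrite /mmap1; elim/big_rec2: _ => [|j l' f' _ fl']; first exact: specializes1.
apply: specializesM fl'; elim: (m j) => [|d IHd].
  by rewrite !expr0; apply: specializes1.
by rewrite !exprS; apply: specializesM.
Qed.

Definition mx_specializes (A : 'M[K]_2) (B : 'M[L]_2) :=
  forall i j, specializes (A i j) (B i j).

Lemma mx_specializes2 a b c d a' b' c' d' :
    specializes a a' -> specializes b b' -> specializes c c' ->
      specializes d d' ->
  mx_specializes (mx2 a b c d) (mx2 a' b' c' d').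
Proof.
move=> ? ? ? ? i j.
by case: (ord2P i) (ord2P j) => -> [] ->; rewrite !mx2E.
Qed.

Lemma mx_specializesM A A' B B' : mx_specializes A A' -> mx_specializes B B' ->
  mx_specializes (A * B) (A' * B').
Proof.
by move=> hA hB i j; rewrite !mul2E; apply: specializesD; apply: specializesM.
Qed.

Lemma mx_specializes1 : mx_specializes 1 1.
Proof.
move=> i j; case: (ord2P i) (ord2P j) => -> [] ->; rewrite !one2E;
  by [apply: specializes0|apply: specializes1].
Qed.

Lemma mx_specializes_val s (M : 'I_s -> 'M[K]_2) (M' : 'I_s -> 'M[L]_2) a :
  (forall i, mx_specializes (M i) (M' i)) ->
    mx_specializes (sl2_val M a) (sl2_val M' a).
Proof.
move=> hM; rewrite /sl2_val /sl2_word.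
elim/big_rec2: _ => [|p B A _ AB]; first exact: mx_specializes1.
apply: mx_specializesM AB; rewrite /sl2_letter; case: ifP => // _.
by apply: mx_specializes2; try apply: specializesN; apply: hM.
Qed.

End Specialization.

(** * Coordinates on a product of copies of SL_2 *)

Section Chart.
Local Open Scope ring_scope.
Variable L : fieldType.

(* The chart a != 0 of SL_2. *)
Definition chart (a b c : L) : 'M[L]_2 := mx2 a b c ((1 + b * c) / a).

Lemma chart_sl2 a b c : a != 0 -> sl2 (chart a b c).
Proof. by move=> a0; rewrite /sl2 !mx2E; field. Qed.

Lemma chartK A : sl2 A -> A 0 0 != 0 -> chart (A 0 0) (A 0 1) (A 1 0) = A.
Proof.
rewrite /sl2 => A1 a0; apply: mx2_eq; rewrite !mx2E //.
by rewrite -A1 subrK mulrC mulKf.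
Qed.

End Chart.

Section Coordinates.
Local Open Scope ring_scope.
Variables (s r : nat).
Hypothesis s_r : (3 * s <= r)%N.

Fact coord_subproof (i : 'I_s) (c : 'I_3) : (3 * i + c < r)%N.
Proof. by have := ltn_ord i; have := ltn_ord c; lia. Qed.
Definition coord (i : 'I_s) (c : 'I_3) : 'I_r := Ordinal (coord_subproof i c).

Variable L : fieldType.

Definition mxs (phi : 'I_r -> L) (i : 'I_s) : 'M[L]_2 :=
  chart (phi (coord i 0)) (phi (coord i 1)) (phi (coord i (inord 2))).

(** Each matrix occupies three consecutive coordinates, in the order of the arguments of [chart];
    [insub] fails from 3s on, where [phi] is kept. *)
Definition coords (N : 'I_s -> 'M[L]_2) (phi : 'I_r -> L) (j : 'I_r) : L :=
  if insub (j %/ 3)%N is Some i then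
    if (j %% 3 == 0)%N then N i 0 0
    else if (j %% 3 == 1)%N then N i 0 1 else N i 1 0
  else phi j.

Lemma coords_coord N phi i (c : 'I_3) : coords N phi (coord i c) =
  if c == 0%N :> nat then N i 0 0
  else if c == 1%N :> nat then N i 0 1 else N i 1 0.
Proof.
rewrite /coords /= mulnC divnMDl // (divn_small (ltn_ord c)) addn0 valK.
by rewrite modnMDl (modn_small (ltn_ord c)).
Qed.

Lemma coord_ind (P : 'I_r -> Prop) : (forall i c, P (coord i c)) ->
  (forall j : 'I_r, insub (j %/ 3)%N = None :> option 'I_s -> P j) ->
    forall j, P j.
Proof.
move=> Pin Pout j; case E: (insub (j %/ 3)%N : option 'I_s) => [i|];
  last exact: Pout.
have ij : i = (j %/ 3)%N :> nat by move: E; case: insubP => // i' _ <- [->].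
have c3 : (j %% 3 < 3)%N by rewrite ltn_mod.
rewrite (_ : j = coord i (Ordinal c3)) //.
by apply: val_inj; rewrite /= ij mulnC -divn_eq.
Qed.

Lemma coords_id N phi : (forall i, N i = mxs phi i) -> coords N phi =1 phi.
Proof.
move=> NE; apply: coord_ind => [i c|j jN]; last by rewrite /coords jN.
rewrite coords_coord NE /mxs !mx2E.
case: c => [[|[|[|]]]] //= c3; congr (phi (coord i _)); apply: val_inj => //=.
by rewrite inordK.
Qed.

Lemma mxs_coords N phi i : sl2 (N i) -> N i 0 0 != 0 ->
  mxs (coords N phi) i = N i.
Proof.
by move=> N1 N0; rewrite /mxs !coords_coord /= inordK //= chartK.
Qed.

End Coordinates.

(** * Birational maps attached to automorphisms of the free group *)

Section WordMaps.
Local Open Scope ring_scope.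
Variables (k : fieldType) (s r : nat).
Hypothesis s_r : (3 * s <= r)%N.
Local Notation K := {fraction {mpoly k[r]}}.
Local Notation tofrac := (@FracField.tofrac {mpoly k[r]}).
Local Notation F := (free_group s).
Local Notation gen := (@presented_gen _ (fun _ _ : seq ('I_s * bool) => False)).
Local Notation coord := (coord s_r).

Definition generic_point (j : 'I_r) : K := tofrac 'X_j.
Definition generic_sl2 : 'I_s -> 'M[K]_2 := mxs s_r generic_point.
Local Notation M := generic_sl2.

Lemma generic_sl2_sl2 i : sl2 (M i).
Proof. by apply: chart_sl2; rewrite tofrac_eq0 -msize_poly_eq0 msizeX. Qed.

(** The only denominators in a word of generic matrices are powers of their top left entries. *)
Lemma generic_specializes (L : fieldType) (theta : {rmorphism {mpoly k[r]} ->
  L}) a :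
    (forall i, theta 'X_(coord i 0) != 0) ->
  mx_specializes theta (sl2_val M a) (sl2_val (mxs s_r (fun j =>
    theta 'X_j)) a).
Proof.
move=> theta0; apply: mx_specializes_val => i.
have X j : specializes theta (generic_point j) (theta 'X_j).
  exact: specializes_poly.
apply: mx_specializes2 => //; apply: specializesM; last exact: specializesV.
by apply: specializesD; [exact: specializes1|exact: specializesM].
Qed.

Lemma sl2_val_const1 (R : comNzRingType) (a : F) : sl2_val (fun=> 1 : 'M[R]_2)
  a = 1.
Proof.
have adj1 : adj2 (1 : 'M[R]_2) = 1.
  by rewrite -[LHS]mulr1 adj2_mul //; apply: sl2_1.
rewrite /sl2_val /sl2_word big1 // => p _; rewrite /sl2_letter adj1.
by case: ifP.
Qed.

(* Specialize the generic matrices to the identity matrix. *)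
Lemma generic_val00_neq0 a : sl2_val M a 0 0 != 0.
Proof.
pose y (j : 'I_r) : k := if (j %% 3 == 0)%N then 1 else 0.
pose theta : {rmorphism {mpoly k[r]} -> k} := mmap idfun y.
have thetaX j : theta 'X_j = y j by rewrite /theta /= mmapX mmap1U.
have y_coord i (c : 'I_3) : y (coord i c) = if c == 0%N :> nat then 1 else 0.
  by rewrite /y /= mulnC modnMDl (modn_small (ltn_ord c)).
have thetaM : mxs s_r (fun j => theta 'X_j) = (fun=> 1).
  apply: funext => i; rewrite /mxs !thetaX !y_coord /= inordK //=.
  by apply: mx2_eq; rewrite !mx2E one2E // mulr0 addr0 divr1.
have := @generic_specializes _ theta a _ 0 0.
rewrite thetaM sl2_val_const1 one2E => sp; apply/eqP => M0.
have : specializes theta 0 1 by rewrite -M0; apply: sp => i;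
  rewrite thetaX y_coord oner_neq0.
by move=> /(specializes_uniq (specializes0 theta))/eqP; rewrite eq_sym oner_eq0.
Qed.

Definition word_map (f : group_aut F) : rational_self_map k r :=
  [ffun j => coords (fun i => sl2_val M (f (gen i))) generic_point j].

Lemma mxs_word_map f i : mxs s_r (word_map f) i = sl2_val M (f (gen i)).
Proof.
rewrite -(@mxs_coords _ _ s_r _ (fun i => sl2_val M (f (gen i))) generic_point).
- by rewrite /mxs !ffunE.
- exact/sl2_val_sl2/generic_sl2_sl2.
- exact: generic_val00_neq0.
Qed.

Lemma word_map_coord0 f i : word_map f (coord i 0) != 0.
Proof. by rewrite ffunE coords_coord generic_val00_neq0. Qed.

Lemma poly_pullbackX (phi : rational_self_map k r) j : poly_pullback phi 'X_j
  = phi j.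
Proof. by rewrite /poly_pullback mmapX mmap1U. Qed.

(** At the point [word_map g] the generic matrices become the words g(x_i), and substituting these
    into f(x_i) gives g(f(x_i)). It is phrased by [specializes] rather than [pullback] because
    dominance is deduced from it. *)
Lemma word_map_specializes f g j :
  specializes (poly_pullback (word_map g)) (word_map f j) (word_map (g * f)%g
    j).
Proof.
rewrite ![word_map _ j]ffunE; set theta : {rmorphism _ -> _} := poly_pullback _.
have thetaX j' : theta 'X_j' = word_map g j' by apply: poly_pullbackX.
have gE : (fun i => sl2_val M ((g * f)%g (gen i))) =
    fun i => sl2_val (mxs s_r (fun j' => theta 'X_j')) (f (gen i)).
  apply: funext => i; rewrite -[(g * f)%g _]/(g (f (gen i))).
  rewrite -(sl2_val_subst _ _ generic_sl2_sl2); congr (sl2_val _ _).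
  by apply: funext => i'; rewrite -mxs_word_map /mxs !thetaX.
rewrite gE /coords; case E: insub => [i|].
  have sp : mx_specializes theta (sl2_val M (f (gen i)))
      (sl2_val (mxs s_r (fun j' => theta 'X_j')) (f (gen i))).
    by apply: generic_specializes => i'; rewrite thetaX word_map_coord0.
  case: (j %% 3 == 0)%N; first exact: sp 0 0.
  by case: (j %% 3 == 1)%N; [exact: sp 0 1|exact: sp 1 0].
have := specializes_poly theta 'X_j.
by rewrite thetaX ffunE /coords E.
Qed.

Lemma word_map1 : word_map 1%g = rational_id k r.
Proof.
apply/ffunP => j; rewrite !ffunE;
  apply: (@coords_id _ _ s_r _ _ generic_point) => i.
exact/sl2_val_gen/generic_sl2_sl2.
Qed.

(* Along word_map f^-1 the coordinates of word_map f specialize to the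
   indeterminates. *)
Lemma word_map_dominant f : dominant (word_map f).
Proof.
move=> p; apply: contraNneq => pf0.
have := @specializes_mmap k r _ (poly_pullback (word_map f^-1%g)) (word_map f)
  (rational_id k r) (@ratconst k r) p.
rewrite -[mmap _ (word_map f) p]/(poly_pullback (word_map f) p) pf0.
rewrite -[mmap _ (rational_id k r) p]/(poly_pullback (rational_id k r) p).
rewrite poly_pullback_id => sp.
rewrite -tofrac_eq0; apply/eqP;
  apply: specializes_uniq (sp _ _) (specializes0 _).
  exact: mmapC.
by move=> j; rewrite -word_map1 -(mulVg f); apply: word_map_specializes.
Qed.

Lemma pullback_specializes (phi : rational_self_map k r) f l : dominant phi ->
  specializes (poly_pullback phi) f l -> pullback phi f = l.
Proof.
move=> domphi [p [q [q0 -> ->]]]; apply: pullback_ratio => //.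
exact: theta_neq0 q0.
Qed.

Lemma word_map_comp f g :
  rational_comp (word_map f) (word_map g) = word_map (g * f)%g.
Proof.
apply/ffunP => j; rewrite ffunE; apply: pullback_specializes.
  exact: word_map_dominant.
exact: word_map_specializes.
Qed.

Lemma word_map_birational f : birational (word_map f).
Proof.
split; first exact: word_map_dominant.
exists (word_map f^-1%g); split; first exact: word_map_dominant.
  by rewrite word_map_comp mulgV word_map1.
by rewrite word_map_comp mulVg word_map1.
Qed.

(** The inverse makes up for [word_map] reversing products. *)
Definition aut_cremona (f : group_aut F) : cremona k r :=
  Cremona (asboolT (word_map_birational f^-1%g)).

Lemma aut_cremonaM : {morph aut_cremona : f g / (f * g)%g}.
Proof. by move=> f g; apply: val_inj; rewrite /= word_map_comp invgM. Qed.
HB.instance Definition _ :=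
  isMultiplicative.Build (group_aut F) (cremona k r) aut_cremona aut_cremonaM.

End WordMaps.

(** * Faithfulness on generic matrices and conclusion *)

Section Faithful.
Local Open Scope ring_scope.
Variables (k : closedFieldType) (s r : nat).
Hypothesis s_r : (3 * s <= r)%N.
Local Notation F := (free_group s).
Local Notation M := (@generic_sl2 k s r s_r).

Lemma generic_val_eq1 (a : F) : sl2_val M a = 1 -> a = 1%g.
Proof.
(* One fixed point for each of the 2s letters. *)
have [zs [zsU zs_size]] := closed_field_uniq_seq k #|{: 'I_s * bool}|.
pose z (p : 'I_s * bool) := zs`_(enum_rank p).
have z_inj : injective z.
  move=> p q /eqP; rewrite nth_uniq ?zs_size ?ltn_ord // => /eqP.
  by move=> /val_inj/enum_rank_inj.
have [w aw rw] := reduced_repr (repr a).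
have aE : a = (\pi_F w)%qT by rewrite -[a]reprK; apply/presented_eqP.
have [w0 _|w0] := eqVneq w [::]; first by rewrite aE w0.
pose N i := loxodromic z (i, true).
have N1 i : sl2 (N i) by apply: loxodromic_sl2.
(* The point over k(X) at which the generic matrices become loxodromic; the value 0 of the
   coordinates from 3s on is arbitrary. *)
pose y : 'I_r -> _ := coords N (fun=> 0).
pose iota : {rmorphism k -> {fraction {poly k}}} := @cst k.
pose theta : {rmorphism {mpoly k[r]} -> {fraction {poly k}}} := mmap iota y.
have thetaX j : theta 'X_j = y j by rewrite /theta /= mmapX mmap1U.
have thetaM : mxs s_r (fun j => theta 'X_j) = N.
  apply: funext => i; have N0 := loxodromic00_neq0 z_inj (i, true).
  by have := mxs_coords s_r (fun=> 0) (N1 i) N0; rewrite /mxs !thetaX.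
move=> a1; case/eqP: (loxodromic_free z_inj w0 rw).
rewrite -(sl2_val_pi N1) -aE; apply/matrixP => i j.
have sp : mx_specializes theta (sl2_val M a) (sl2_val N a).
  rewrite -thetaM; apply: generic_specializes => i'.
  by rewrite thetaX /y coords_coord loxodromic00_neq0.
apply: specializes_uniq (sp i j) _; rewrite a1; exact: mx_specializes1.
Qed.

Lemma generic_val_inj : injective (sl2_val M : F -> _).
Proof.
move=> a b ab; apply/divg1_eq/generic_val_eq1.
rewrite sl2_valM ?sl2_valV ?ab ?mul2_adj //; try exact: generic_sl2_sl2.
exact/sl2_val_sl2/generic_sl2_sl2.
Qed.

(** The matrices read off from [word_map f] are the words f(x_i) at the generic matrices, and these
    values determine the words. *)
Lemma aut_cremona_inj : injective (@aut_cremona k s r s_r).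
Proof.
move=> f g /(congr1 (@cremona_map k r)) /= fg; apply: invg_inj.
apply/group_aut_eq/presented_hom_ext => i; apply: generic_val_inj.
by rewrite -!(@mxs_word_map k s r s_r) fg.
Qed.

End Faithful.

Theorem corollary9 (k : closedFieldType) (n r s : nat)
    (hn : (1 <= n)%N) (hr : (3 * n <= r)%N) (hs2 : (2 <= s)%N) (hsn : (s <= n)%N) :
  contains_group (cremona k r) (group_aut (free_group s)) /\
  ((3 <= n)%N -> contains_group (cremona k r) (braid_group n)).
Proof.
split=> [|_].
  have sr : (3 * s <= r)%N by lia.
  by exists (@aut_cremona k s r sr); apply: aut_cremona_inj.
(* Artin's embedding followed by the embedding of Aut(F_n), the case s = n. *)
exists (@aut_cremona k n r hr \o @artin n : {multiplicative _ -> _}).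
exact: inj_comp (@aut_cremona_inj k n r hr) (@artin_faithful n).
Qed.
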